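(* Let $L$ have dimension $d_L$, $A=A_1\otimes\cdots\otimes A_n$ finite-dimensional, and $V:L\to A$ an isometry with $\mathcal{E}(\cdot)=V(\cdot)V^\dagger$. Let $T_L$ be Hermitian on $L$ and $T_A=\sum_{i=1}^nT_i$ with $T_i$ Hermitian acting only on $A_i$, and suppose the code is covariant: $T_AV=V(T_L-\nu\mathbb{1}_L)$ for some $\nu\in\mathbb{R}$. For each $i$ let $\mathcal{N}^i(\cdot)=|\phi_i\rangle\langle\phi_i|_{A_i}\otimes\operatorname{tr}_{A_i}(\cdot)$ be the erasure of $A_i$, and let $\Delta T_i$ be the difference between the maximal and minimal eigenvalues of $T_i$. Then $$\frac{1}{2d_L}\left\|T_L-\operatorname{tr}(T_L)\frac{\mathbb{1}}{d_L}\right\|_1\leq\sum_{i=1}^n\Delta T_i\,\epsilon_{\mathrm e}(\mathcal{N}^i\circ\mathcal{E}).$$ Furthermore, for the noise $\mathcal{N}(\cdot)=\sum_iq_i|i\rangle\langle i|_C\otimes\mathcal{N}^i(\cdot)$ with a probability distribution $q_i>0$, $$\epsilon_{\mathrm e}(\mathcal{N}\circ\mathcal{E})\geq\frac{1}{2d_L}\frac{\|T_L-\operatorname{tr}(T_L)\mathbb{1}/d_L\|_1}{\max_iq_i^{-1}\Delta T_i}.$$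
   Context: Fidelity $F(\rho,\sigma)=\|\sqrt\rho\sqrt\sigma\|_1$; $|\hat\phi\rangle_{LR}=\sum_k|k\rangle|k\rangle/\sqrt{d_L}$ with $R\cong L$. For a channel $\mathcal{M}$ from $L$ to $B$, $f_{\mathrm e}(\mathcal{M})=\max_{\mathcal{R}}F((\mathcal{R}\circ\mathcal{M}\otimes\mathrm{id}_R)(\hat\phi),\hat\phi)$ over channels $\mathcal{R}:B\to L$, and $\epsilon_{\mathrm e}(\mathcal{M})=\sqrt{1-f_{\mathrm e}^2(\mathcal{M})}$. *)

(* Defs.v *)
From Stdlib Require Import ClassicalEpsilon.
From mathcomp Require Import all_boot all_order all_algebra.
From mathcomp Require Import complex.
From mathcomp Require Import classical_sets reals.
Set Implicit Arguments. Unset Strict Implicit. Unset Printing Implicit Defensive.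
Import Order.TTheory GRing.Theory Num.Theory.
Local Open Scope ring_scope.
Local Open Scope classical_set_scope.

(* Finite-dimensional Hilbert spaces are C^I for a finite index type I,
   with C = R[i], R a real number field (realType).  Operators from C^J to C^I
   are I x J arrays of complex numbers.                                       *)
Section Quantum.
Variable R : realType.
Local Notation C := (R[i]).

Definition op (I J : finType) := I -> J -> C.

Definition opmul (I J K : finType) (X : op I J) (Y : op J K) : op I K :=
  fun i k => \sum_(j : J) X i j * Y j k.
Definition qadj (I J : finType) (X : op I J) : op J I := fun j i => (X i j)^*.
Definition opadd (I J : finType) (X Y : op I J) : op I J := fun i j => X i j + Y i j.
Definition opscale (I J : finType) (a : C) (X : op I J) : op I J := fun i j => a * X i j.
Definition op1 (I : finType) : op I I := fun i j => (i == j)%:R.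
Definition op0 (I J : finType) : op I J := fun _ _ => 0.
Definition qtr (I : finType) (X : op I I) : C := \sum_(i : I) X i i.

Definition qhermitian (I : finType) (X : op I I) : Prop := qadj X = X.
Definition psd (I : finType) (X : op I I) : Prop :=
  qhermitian X /\ forall v : I -> C, 0 <= \sum_(i : I) \sum_(j : I) (v i)^* * X i j * v j.

(* the (positive semidefinite) square root: the PSD Y with Y Y = X
   (unique when X is PSD) *)
Definition sqrtm (I : finType) (X : op I I) : op I I :=
  epsilon (inhabits (@op0 I I)) (fun Y => psd Y /\ opmul Y Y = X).

Definition tnorm (I J : finType) (X : op I J) : R :=
  complex.Re (qtr (sqrtm (opmul (qadj X) X))).

Definition fidelity (I : finType) (rho sigma : op I I) : R :=
  tnorm (opmul (sqrtm rho) (sqrtm sigma)).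

Definition linmap (I J : finType) (M : op I I -> op J J) : Prop :=
  forall (a : C) (X Y : op I I), M (opadd (opscale a X) Y) = opadd (opscale a (M X)) (M Y).

Definition ext (I J K : finType) (M : op I I -> op J J) (X : op (I * K)%type (I * K)%type)
  : op (J * K)%type (J * K)%type :=
  fun jk jk' => M (fun i i' => X (i, jk.2) (i', jk'.2)) jk.1 jk'.1.

Definition channel (I J : finType) (M : op I I -> op J J) : Prop :=
  [/\ linmap M,
      (forall (K : finType) (X : op (I * K)%type (I * K)%type), psd X -> psd (ext M X)) &
      (forall X : op I I, qtr (M X) = qtr X)].

(* maximally entangled state |phi^> = sum_k |k>|k> / sqrt d_L on L (x) R, R = L *)
Definition maxent (L : finType) : op (L * L)%type (L * L)%type :=
  fun ab cd => ((ab.1 == ab.2) && (cd.1 == cd.2))%:R / (#|L|%:R).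

(* entanglement fidelity f_e(M) = max over recovery channels (sup; it is attained) *)
Definition fe (L B : finType) (M : op L L -> op B B) : R :=
  sup [set x : R | exists Rc : op B B -> op L L,
        channel Rc /\ x = fidelity (ext (Rc \o M) (@maxent L)) (@maxent L)].

Definition eps_e (L B : finType) (M : op L L -> op B B) : R :=
  Num.sqrt (1 - fe M ^+ 2).

Definition eigenvalues (I : finType) (T : op I I) : set R :=
  [set x : R | exists v : I -> C, (exists i, v i != 0) /\
      forall i, \sum_(j : I) T i j * v j = real_complex R x * v i].

Definition spread (I : finType) (T : op I I) : R :=
  sup (eigenvalues T) - inf (eigenvalues T).

(* Tensor product A = A_1 (x) ... (x) A_n; basis indexed by dependent functions *)
Definition tensT (n : nat) (Ai : 'I_n -> finType) : finType :=
  {dffun forall i : 'I_n, Ai i}.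

Definition upd (n : nat) (Ai : 'I_n -> finType) (a : tensT Ai) (i : 'I_n) (x : Ai i)
  : tensT Ai := [ffun j => dfwith (fun k => a k) x j].

Definition local_sum (n : nat) (Ai : 'I_n -> finType) (T : forall i, op (Ai i) (Ai i))
  : op (tensT Ai) (tensT Ai) :=
  fun a a' => \sum_(i < n)
     T i (a i) (a' i) * [forall j, (j != i) ==> (a j == a' j)]%:R.

Definition erasure (n : nat) (Ai : 'I_n -> finType) (i : 'I_n) (phi : Ai i -> C)
  (X : op (tensT Ai) (tensT Ai)) : op (tensT Ai) (tensT Ai) :=
  fun a a' => phi (a i) * (phi (a' i))^* * \sum_(x : Ai i) X (upd a x) (upd a' x).

Definition mixed_erasure (n : nat) (Ai : 'I_n -> finType) (q : 'I_n -> R)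
  (phi : forall i, Ai i -> C) (X : op (tensT Ai) (tensT Ai))
  : op ('I_n * tensT Ai)%type ('I_n * tensT Ai)%type :=
  fun ca ca' => (ca.1 == ca'.1)%:R * real_complex R (q ca.1)
                 * erasure (phi ca.1) X ca.2 ca'.2.

Definition encode (L A : finType) (V : op A L) (X : op L L) : op A A :=
  opmul (opmul V X) (qadj V).

End Quantum.

(* Main.v *)
Require Import Defs.
From Stdlib Require Import ClassicalEpsilon.
From mathcomp Require Import all_boot all_order all_algebra.
From mathcomp Require Import complex.
From mathcomp Require Import boolp classical_sets reals.
From mathcomp Require Import ring lra.
Import Order.TTheory GRing.Theory Num.Theory.
Local Open Scope ring_scope.
Set Implicit Arguments. Unset Strict Implicit.

(* Let [P] be the positive spectral projection of the traceless part [TL0] of [TL] and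
   [Z = P - tr P / d], so that [tr (TL0 Z) = |TL0|_1 / 2], [tr Z = 0] and [|Z| <= 1].  By
   covariance [tr (TL0 Z) = sum_i tr (V^* T_i V Z)].
   For a recovery with Kraus operators [K_j] and the Kraus operators [N_x] of "encode, then
   erase site i" (indexed by the erased register [x]), the vectors [K_j N_x] purify the joint
   state of site [i] and the reference, so [tr (V^* T_i V Z)] is the expectation of
   [T_i (x) Z] in [u = (K_j N_x)_{j,x}], a vector of squared norm [d].  The squared entanglement fidelity is the weight
   of [u] on the vectors [(a_{jx} 1)_{j,x}], in which [T_i (x) Z] has expectation zero since
   [tr Z = 0].  Subtracting a constant from [T_i] makes [T_i (x) Z] of norm at most
   [Delta T_i / 2], and its expectations in two unit vectors of overlap [F] then differ by
   at most [Delta T_i sqrt (1 - F^2)].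
   For the mixed noise the recovery splits into recoveries of the single erasures, with
   [F^2 = sum_i q_i F_i^2], and the second bound follows by convexity of the square. *)

(** * Operator algebra and the spectral theorem *)

Section OperatorAlgebra.
Variable R : realType.
Local Notation C := (R[i]).
Local Notation rc := (real_complex R).
Implicit Types I J K : finType.

Lemma op_ext I J (X Y : op R I J) : (forall i j, X i j = Y i j) -> X = Y.
Proof. by move=> h; apply: funext => i; apply: funext => j. Qed.

Lemma opmulA I J K M (X : op R I J) (Y : op R J K) (Z : op R K M) :
  opmul X (opmul Y Z) = opmul (opmul X Y) Z.
Proof.
apply: op_ext => i m; rewrite /opmul.
under eq_bigr do rewrite big_distrr /=.
rewrite exchange_big /=; apply: eq_bigr => k _.
by rewrite big_distrl /=; apply: eq_bigr => j _; rewrite mulrA.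
Qed.

Lemma opmul1l I J (X : op R I J) : opmul (@op1 R I) X = X.
Proof.
apply: op_ext => i j; rewrite /opmul (bigD1 i) //= /op1 eqxx mul1r big1 ?addr0 //.
by move=> k ki; rewrite eq_sym (negPf ki) mul0r.
Qed.

Lemma opmul1r I J (X : op R I J) : opmul X (@op1 R J) = X.
Proof.
apply: op_ext => i j; rewrite /opmul (bigD1 j) //= /op1 eqxx mulr1 big1 ?addr0 //.
by move=> k ki; rewrite (negPf ki) mulr0.
Qed.

Lemma qadj_mul I J K (X : op R I J) (Y : op R J K) :
  qadj (opmul X Y) = opmul (qadj Y) (qadj X).
Proof.
apply: op_ext => k i; rewrite /qadj /opmul rmorph_sum /=.
by apply: eq_bigr => j _; rewrite rmorphM mulrC.
Qed.

Lemma qadjK I J (X : op R I J) : qadj (qadj X) = X.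
Proof. by apply: op_ext => i j; rewrite /qadj conjCK. Qed.

Lemma qtrC I J (X : op R I J) (Y : op R J I) : qtr (opmul X Y) = qtr (opmul Y X).
Proof.
rewrite /qtr /opmul exchange_big /=; apply: eq_bigr => j _.
by apply: eq_bigr => i _; rewrite mulrC.
Qed.

Lemma opmulDl I J K (X Y : op R I J) (Z : op R J K) :
  opmul (opadd X Y) Z = opadd (opmul X Z) (opmul Y Z).
Proof.
apply: op_ext => i k; rewrite /opmul /opadd -big_split.
by apply: eq_bigr => j _; rewrite mulrDl.
Qed.

Lemma opmulZl I J K (a : C) (X : op R I J) (Z : op R J K) :
  opmul (opscale a X) Z = opscale a (opmul X Z).
Proof.
apply: op_ext => i k; rewrite /opmul /opscale big_distrr.
by apply: eq_bigr => j _; rewrite -mulrA.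
Qed.

Lemma opmulDr I J K (X : op R I J) (Y Z : op R J K) :
  opmul X (opadd Y Z) = opadd (opmul X Y) (opmul X Z).
Proof.
apply: op_ext => i k; rewrite /opmul /opadd -big_split.
by apply: eq_bigr => j _; rewrite mulrDr.
Qed.

Lemma opmulZr I J K (a : C) (X : op R I J) (Z : op R J K) :
  opmul X (opscale a Z) = opscale a (opmul X Z).
Proof.
apply: op_ext => i k; rewrite /opmul /opscale big_distrr.
by apply: eq_bigr => j _; rewrite mulrCA.
Qed.

Lemma qtrD I (X Y : op R I I) : qtr (opadd X Y) = qtr X + qtr Y.
Proof. by rewrite /qtr -big_split. Qed.

Lemma qtrZ I a (X : op R I I) : qtr (opscale a X) = a * qtr X.
Proof. by rewrite /qtr big_distrr. Qed.

Lemma qtr1 I : qtr (@op1 R I) = #|I|%:R.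
Proof. by rewrite /qtr /op1; under eq_bigr do rewrite eqxx; rewrite sumr_const. Qed.

Lemma conj_rc (x : R) : Num.conj (rc x) = rc x.
Proof. exact: conjc_real. Qed.

Lemma normCK_ge0 (z : C) : 0 <= Num.conj z * z.
Proof. by rewrite mulrC -normCK exprn_ge0. Qed.

(** Functional calculus: [U] carries the eigenvectors as columns and [f] the real spectrum.
    Hermitian operators are handled below as such pairs, so that products, square roots, norms and
    shifts become pointwise operations on [f]. *)
Definition fcal I (U : op R I I) (f : I -> R) : op R I I :=
  fun i j => \sum_k U i k * rc (f k) * Num.conj (U j k).

Definition qunitary I (U : op R I I) :=
  opmul (qadj U) U = @op1 R I /\ opmul U (qadj U) = @op1 R I.

Lemma fcal_herm I (U : op R I I) f : qhermitian (fcal U f).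
Proof.
apply: op_ext => i j; rewrite /qadj /fcal rmorph_sum; apply: eq_bigr => k _.
rewrite !rmorphM /= conj_rc conjCK; ring.
Qed.

Lemma fcal_mul I (U : op R I I) f g : qunitary U ->
  opmul (fcal U f) (fcal U g) = fcal U (fun k => f k * g k).
Proof.
move=> [U1 _]; apply: op_ext => i j; rewrite /opmul /fcal.
under eq_bigr do rewrite big_distrl /=.
rewrite exchange_big /=; apply: eq_bigr => k _.
under eq_bigr do rewrite big_distrr /=.
rewrite exchange_big /= (bigD1 k) //= [X in _ + X]big1 ?addr0 => [|m mk].
  transitivity (U i k * rc (f k) * (rc (g k) * Num.conj (U j k)) * opmul (qadj U) U k k).
    by rewrite /opmul big_distrr /=; apply: eq_bigr => l _; rewrite /qadj; ring.
  by rewrite U1 /op1 eqxx rmorphM /=; ring.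
transitivity (U i k * rc (f k) * (rc (g m) * Num.conj (U j m)) * opmul (qadj U) U k m).
  by rewrite /opmul big_distrr /=; apply: eq_bigr => l _; rewrite /qadj; ring.
by rewrite U1 /op1 eq_sym (negPf mk) mulr0.
Qed.

Lemma fcal_cst I (U : op R I I) c : qunitary U ->
  fcal U (fun=> c) = opscale (rc c) (@op1 R I).
Proof.
move=> [_ <-]; apply: op_ext => i j; rewrite /fcal /opscale /opmul big_distrr /=.
by apply: eq_bigr => k _; rewrite /qadj; ring.
Qed.

Lemma fcalD I (U : op R I I) f g :
  opadd (fcal U f) (fcal U g) = fcal U (fun k => f k + g k).
Proof.
apply: op_ext => i j; rewrite /opadd /fcal -big_split /=.
by apply: eq_bigr => k _; rewrite rmorphD /=; ring.
Qed.

Lemma qtr_fcal I (U : op R I I) f : qunitary U -> qtr (fcal U f) = rc (\sum_k f k).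
Proof.
move=> [U1 _]; rewrite /qtr /fcal exchange_big rmorph_sum; apply: eq_bigr => k _.
transitivity (rc (f k) * opmul (qadj U) U k k).
  by rewrite /opmul big_distrr /=; apply: eq_bigr => l _; rewrite /qadj; ring.
by rewrite U1 /op1 eqxx mulr1.
Qed.

Lemma fcal_psd I (U : op R I I) f : (forall k, 0 <= f k) -> psd (fcal U f).
Proof.
move=> f0; split; first exact: fcal_herm.
move=> v.
suff -> : \sum_i \sum_j Num.conj (v i) * fcal U f i j * v j =
   \sum_k rc (f k) * (Num.conj (\sum_j Num.conj (U j k) * v j) * (\sum_j Num.conj (U j k) * v j)).
  by apply: sumr_ge0 => k _; rewrite mulr_ge0 ?normCK_ge0 // ler0c.
transitivity (\sum_i \sum_j \sum_k Num.conj (v i) * U i k * rc (f k) * Num.conj (U j k) * v j).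
  apply: eq_bigr => i _; apply: eq_bigr => j _.
  by rewrite /fcal mulr_sumr mulr_suml; apply: eq_bigr => k _; ring.
under eq_bigr do rewrite exchange_big /=.
rewrite exchange_big /=; apply: eq_bigr => k _.
rewrite rmorph_sum /= mulr_suml mulr_sumr; apply: eq_bigr => i _.
rewrite !mulr_sumr; apply: eq_bigr => j _.
by rewrite rmorphM /= conjCK; ring.
Qed.

Theorem spectral I (X : op R I I) : qhermitian X ->
  exists (U : op R I I) (f : I -> R), qunitary U /\ X = fcal U f.
Proof.
move=> hX; pose A := \matrix_(i < #|I|, j < #|I|) X (enum_val i) (enum_val j).
have hA : A \is hermsymmx.
  apply/is_hermitianmxP; rewrite expr0 scale1r; apply/matrixP => i j.
  by rewrite !mxE -{1}hX.
have /orthomx_spectralP := hermitian_normalmx hA.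
have Pu := spectral_unitarymx A.
have Dr := hermitian_spectral_diag_real hA.
rewrite invmx_unitary //; set P := spectralmx A in Pu *; set D := spectral_diag A in Dr *.
move=> AE.
have /unitarymxP PP := Pu.
have /unitarymxP PP' : (map_mx Num.conj P^T) \is unitarymx by rewrite trmxC_unitary.
rewrite trmxCK in PP'.
(* The matrix decomposition reads A = P^* D P, so the eigenvectors are the columns of P^*. The
   diagonal D is real because A is hermitian, hence taking [Re] of it loses nothing. *)
pose U : op R I I := fun i k => Num.conj (P (enum_rank k) (enum_rank i)).
exists U, (fun k => complex.Re (D 0 (enum_rank k))).
have sumE (F : 'I_#|I| -> C) : \sum_k F k = \sum_(i : I) F (enum_rank i).
  by rewrite (reindex enum_rank) //; exists enum_val => k _; rewrite ?enum_valK ?enum_rankK.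
have e1 (i j : I) : ((enum_rank i == enum_rank j)%:R : C) = (i == j)%:R.
  by rewrite (inj_eq enum_rank_inj).
split; first split; apply: op_ext => i j.
- have /matrixP/(_ (enum_rank i) (enum_rank j)) := PP.
  rewrite !mxE sumE e1 /opmul /op1 => <-; apply: eq_bigr => k _.
  by rewrite /qadj /U !mxE conjCK.
- have /matrixP/(_ (enum_rank i) (enum_rank j)) := PP'.
  rewrite !mxE sumE e1 /opmul /op1 => <-; apply: eq_bigr => k _.
  by rewrite /qadj /U !mxE conjCK.
- have /matrixP/(_ (enum_rank i) (enum_rank j)) := AE.
  rewrite !mxE !enum_rankK sumE => ->; apply: eq_bigr => k _.
  rewrite mul_mx_diag !mxE /U conjCK; congr (_ * _ * _).
  have /mxOverP/(_ 0 (enum_rank k)) := Dr.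
  by move=> /RRe_real.
Qed.
End OperatorAlgebra.

(** * Square roots, trace norm, fidelity with the maximally entangled state *)

Section SquareRoots.
Variable R : realType.
Local Notation C := (R[i]).
Local Notation rc := (real_complex R).
Implicit Types I J K : finType.

Lemma psd_gram I J (S : op R I J) : psd (opmul (qadj S) S).
Proof.
split=> [|v]; first by rewrite /qhermitian qadj_mul qadjK.
suff -> : \sum_i \sum_j Num.conj (v i) * opmul (qadj S) S i j * v j =
    \sum_k Num.conj (\sum_j S k j * v j) * (\sum_j S k j * v j).
  by apply: sumr_ge0 => k _; exact: normCK_ge0.
transitivity (\sum_i \sum_j \sum_k Num.conj (v i) * Num.conj (S k i) * S k j * v j).
  apply: eq_bigr => i _; apply: eq_bigr => j _.
  by rewrite /opmul mulr_sumr mulr_suml; apply: eq_bigr => k _; rewrite /qadj; ring.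
under eq_bigr do rewrite exchange_big /=.
rewrite exchange_big /=; apply: eq_bigr => k _.
rewrite rmorph_sum /= mulr_suml; apply: eq_bigr => i _.
rewrite mulr_sumr; apply: eq_bigr => j _.
by rewrite rmorphM /=; ring.
Qed.

Lemma fcal_mulU I (U : op R I I) f i k : qunitary U ->
  opmul (fcal U f) U i k = U i k * rc (f k).
Proof.
move=> [U1 _]; rewrite /opmul /fcal.
under eq_bigr do rewrite mulr_suml.
rewrite exchange_big (bigD1 k) //= [X in _ + X]big1 ?addr0 => [|m mk].
  transitivity (U i k * rc (f k) * opmul (qadj U) U k k).
    by rewrite /opmul mulr_sumr; apply: eq_bigr => l _; rewrite /qadj; ring.
  by rewrite U1 /op1 eqxx mulr1.
transitivity (U i m * rc (f m) * opmul (qadj U) U m k).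
  by rewrite /opmul mulr_sumr; apply: eq_bigr => l _; rewrite /qadj; ring.
by rewrite U1 /op1 (negPf mk) mulr0.
Qed.

Lemma psd_spectral I (X : op R I I) : psd X ->
  exists (U : op R I I) (f : I -> R), [/\ qunitary U, (forall k, 0 <= f k) & X = fcal U f].
Proof.
move=> [/spectral[U [f [Uu XE]]] pX]; exists U, f; split=> // k.
(* The quadratic form at the k-th eigenvector is the k-th eigenvalue. *)
have := pX (fun i => U i k).
suff -> : \sum_i \sum_j Num.conj (U i k) * X i j * U j k = rc (f k) by rewrite ler0c.
transitivity (\sum_i Num.conj (U i k) * opmul X U i k).
  by apply: eq_bigr => i _; rewrite /opmul mulr_sumr; apply: eq_bigr => j _; ring.
transitivity (rc (f k) * opmul (qadj U) U k k).
  rewrite [in RHS]/opmul mulr_sumr; apply: eq_bigr => i _.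
  by rewrite XE fcal_mulU // /qadj; ring.
by rewrite Uu.1 /op1 eqxx mulr1.
Qed.

(** Uniqueness of the positive square root. Equality of two such operators means that Q = W^* U
    intertwines their spectra entrywise ([QE]). Wherever Q has a nonzero entry the squares agree,
    hence so do the nonnegative values, and Q intertwines [f] and [g] as well. *)
Lemma fcal_inj_sqr I (U W : op R I I) (f g : I -> R) : qunitary U -> qunitary W ->
  (forall k, 0 <= f k) -> (forall k, 0 <= g k) ->
  fcal U (fun k => f k * f k) = fcal W (fun k => g k * g k) -> fcal U f = fcal W g.
Proof.
move=> Uu Wu f0 g0 E; pose Q := opmul (qadj W) U.
have QE (h1 h2 : I -> R) : (forall m k, rc (h2 m) * Q m k = Q m k * rc (h1 k)) <->
    fcal U h1 = fcal W h2.
  have e1 m k : opmul (qadj W) (opmul (fcal U h1) U) m k = Q m k * rc (h1 k).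
    rewrite /Q [in RHS]/opmul mulr_suml; apply: eq_bigr => i _.
    by rewrite fcal_mulU //; ring.
  have e2 m k : opmul (qadj W) (opmul (fcal W h2) U) m k = rc (h2 m) * Q m k.
    have -> : opmul (qadj W) (opmul (fcal W h2) U) =
        opmul (qadj (opmul (fcal W h2) W)) U.
      by rewrite qadj_mul fcal_herm opmulA.
    rewrite /Q [in RHS]/opmul mulr_sumr; apply: eq_bigr => i _.
    by rewrite /qadj fcal_mulU // rmorphM /= conj_rc; ring.
  split=> [h|h m k]; last by rewrite -e2 -e1 h.
  have : opmul (qadj W) (opmul (fcal U h1) U) = opmul (qadj W) (opmul (fcal W h2) U).
    by apply: op_ext => m k; rewrite e1 e2 h.
  move=> /(congr1 (opmul W)); rewrite !(opmulA W) Wu.2 !opmul1l.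
  by move=> /(congr1 (fun X => opmul X (qadj U))); rewrite -!opmulA Uu.2 !opmul1r.
apply/QE => m k; move/QE: E => /(_ m k).
have [->|Q0] := eqVneq (Q m k) 0; first by rewrite !(mul0r, mulr0).
rewrite [in X in X = _]mulrC => /(mulfI Q0)/complexI.
rewrite -!expr2 => /eqP; rewrite eqrXn2 // => /eqP ->.
by rewrite mulrC.
Qed.

(** [sqrtm] is an arbitrary choice among positive roots; uniqueness is what allows it to be computed
    by exhibiting a root. *)
Lemma sqrtm_eq I (X Y : op R I I) : psd Y -> opmul Y Y = X -> sqrtm X = Y.
Proof.
move=> pY YX; rewrite /sqrtm.
have [pZ ZX] := epsilon_spec (inhabits (op0 R (I:=I) (J:=I)))
   (fun Y => psd Y /\ opmul Y Y = X) (ex_intro _ Y (conj pY YX)).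
move: (epsilon _ _) pZ ZX => Z /psd_spectral[W [g [Wu g0 ->]]].
move: pY YX => /psd_spectral[U [f [Uu f0 ->]]] <-.
by rewrite !fcal_mul //; exact: fcal_inj_sqr.
Qed.

Lemma sqrtmP I (X : op R I I) : psd X ->
  psd (sqrtm X) /\ opmul (sqrtm X) (sqrtm X) = X.
Proof.
move=> /psd_spectral[U [f [Uu f0 ->]]].
apply: (epsilon_spec _ (fun Y => psd Y /\ opmul Y Y = _)); exists (fcal U (fun k => Num.sqrt (f k))).
split; first by apply: fcal_psd => k; exact: sqrtr_ge0.
rewrite fcal_mul //; congr fcal; apply: funext => k.
by rewrite -expr2 sqr_sqrtr.
Qed.

Lemma tnorm_fcal I (U : op R I I) f : qunitary U -> tnorm (fcal U f) = \sum_k `|f k|.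
Proof.
move=> Uu; rewrite /tnorm (sqrtm_eq (Y := fcal U (fun k => `|f k|))) ?qtr_fcal //.
  by apply: fcal_psd.
rewrite fcal_herm !fcal_mul //; congr fcal; apply: funext => k.
by rewrite -normrM ger0_norm // -expr2 sqr_ge0.
Qed.

(** A projection is its own square root, so the modulus squared of sqrt(rho) P is P rho P = c P,
    whose root is sqrt(c) P, of trace sqrt(c). *)
Lemma fidelity_proj I (rho P : op R I I) (c : R) : psd rho -> psd P ->
  opmul P P = P -> qtr P = 1 -> opmul P (opmul rho P) = opscale (rc c) P -> 0 <= c ->
  fidelity rho P = Num.sqrt c.
Proof.
move=> prho pP PP trP PrP c0; rewrite /fidelity (sqrtm_eq pP PP) /tnorm.
have [[hS _] SS] := sqrtmP prho.
rewrite qadj_mul hS (proj1 pP) -opmulA [opmul (sqrtm rho) _]opmulA SS PrP.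
have hs0 : 0 <= Num.sqrt c by exact: sqrtr_ge0.
rewrite (sqrtm_eq (Y := opscale (rc (Num.sqrt c)) P)).
- by rewrite qtrZ trP mulr1.
- split.
    apply: op_ext => i j; rewrite /qadj /opscale rmorphM /= conj_rc.
    by congr (_ * _); exact: (congr1 (fun X => X i j) pP.1).
  move=> v; have -> : \sum_i \sum_j Num.conj (v i) * opscale (rc (Num.sqrt c)) P i j * v j =
     rc (Num.sqrt c) * \sum_i \sum_j Num.conj (v i) * P i j * v j.
    rewrite mulr_sumr; apply: eq_bigr => i _; rewrite mulr_sumr; apply: eq_bigr => j _.
    by rewrite /opscale; ring.
  by rewrite mulr_ge0 ?ler0c //; exact: pP.2.
- rewrite opmulZl opmulZr PP; apply: op_ext => i j; rewrite /opscale mulrA -rmorphM /=.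
  by rewrite -expr2 sqr_sqrtr.
Qed.

Lemma maxent_idem (L : finType) : (0 < #|L|)%N ->
  opmul (@maxent R L) (@maxent R L) = @maxent R L.
Proof.
move=> L0; have d0 : (#|L|%:R : C) != 0 by rewrite pnatr_eq0 -lt0n.
apply: op_ext => -[a b] [c d]; rewrite /opmul /maxent /=.
rewrite (eq_bigr (fun p : L * L => (p.1 == p.2)%:R * (((a == b) && (c == d))%:R / #|L|%:R / #|L|%:R))).
  rewrite -mulr_suml -(pair_bigA _ (fun x y => (x == y)%:R)) /=.
  have -> : \sum_(x : L) \sum_(y : L) ((x == y)%:R : C) = #|L|%:R.
    rewrite -sumr_const; apply: eq_bigr => x _.
    by rewrite (bigD1 x) //= eqxx big1 ?addr0 // => y yx; rewrite eq_sym (negPf yx).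
  by field.
move=> [x y] _ /=; case: (a == b) => /=; last by ring.
by case: (x == y) => /=; ring.
Qed.

Lemma maxent_herm (L : finType) : qhermitian (@maxent R L).
Proof.
apply: op_ext => -[a b] [c d]; rewrite /qadj /maxent /= fmorph_div /= !conjC_nat.
by rewrite andbC.
Qed.

Lemma psd_maxent (L : finType) : (0 < #|L|)%N -> psd (@maxent R L).
Proof.
by move=> L0; rewrite -(maxent_idem L0) -{1}(@maxent_herm L); exact: psd_gram.
Qed.

(** [maxent] is a rank-one projection, so it compresses rho to the scalar c, the expectation of rho
    in the maximally entangled vector. *)
Lemma fidelity_maxent (L : finType) (rho : op R (L * L)%type (L * L)%type) (c : R) :
  (0 < #|L|)%N -> psd rho ->
  rc c = (\sum_k \sum_l rho (k, k) (l, l)) / #|L|%:R ->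
  0 <= c /\ fidelity rho (@maxent R L) = Num.sqrt c.
Proof.
move=> L0 prho cE; have d0 : (#|L|%:R : C) != 0 by rewrite pnatr_eq0 -lt0n.
have diagE (F : L * L -> C) : \sum_p (p.1 == p.2)%:R * F p = \sum_k F (k, k).
  rewrite (eq_bigr (fun p : L * L => (p.1 == p.2)%:R * F (p.1, p.2))); last by case.
  rewrite -(pair_bigA _ (fun x y => (x == y)%:R * F (x, y))) /=.
  apply: eq_bigr => x _; rewrite (bigD1 x) //= eqxx mul1r big1 ?addr0 // => y yx.
  by rewrite eq_sym (negPf yx) mul0r.
have c0 : 0 <= c.
  rewrite -ler0c cE mulr_ge0 ?invr_ge0 ?ler0n //.
  (* The test vector is the unnormalised maximally entangled vector sum_k |k>|k>. *)
  have := prho.2 (fun p => (p.1 == p.2)%:R).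
  congr (0 <= _); rewrite -(diagE (fun p => \sum_l rho p (l, l))); apply: eq_bigr => p _.
  rewrite -(diagE (fun q => rho p q)) mulr_sumr; apply: eq_bigr => q _; rewrite conjC_nat; ring.
split=> //; apply: fidelity_proj => //; first exact: psd_maxent.
- exact: maxent_idem.
- rewrite /qtr /maxent /=; under eq_bigr do rewrite andbb.
  by rewrite (diagE (fun=> _)) sumr_const -[_ *+ _]mulr_natr; field.
apply: op_ext => -[a b] [x y]; rewrite /opscale cE /opmul.
transitivity (\sum_p (p.1 == p.2)%:R * (\sum_q (q.1 == q.2)%:R *
   (rho p q * (((a == b) && (x == y))%:R / #|L|%:R / #|L|%:R)))).
  apply: eq_bigr => p _; rewrite !mulr_sumr; apply: eq_bigr => q _.
  rewrite /maxent /=; case: (a == b); case: (x == y); case: (p.1 == p.2); case: (q.1 == q.2) => /=; ring.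
rewrite diagE; under eq_bigr do rewrite diagE -mulr_suml.
by rewrite -mulr_suml /maxent /=; ring.
Qed.
End SquareRoots.

(** * Expectations of observables in nearby pure states *)

Section RealInnerProduct.
Variable R : realType.
Local Notation C := (R[i]).
Local Notation rc := (real_complex R).
Local Notation Re := (@complex.Re R).
Implicit Types I J K P Q S X : finType.

Lemma ReD (x y : C) : Re (x + y) = Re x + Re y.
Proof. by case: x; case: y. Qed.

Lemma Re_rc (a : R) (x : C) : Re (rc a * x) = a * Re x.
Proof. by case: x => x y /=; rewrite mul0r subr0. Qed.

Lemma Re_conj (x : C) : Re (Num.conj x) = Re x.
Proof. by case: x. Qed.

Lemma sqr_le (x y : R) : 0 <= y -> x ^+ 2 <= y ^+ 2 -> x <= y.
Proof. by move=> y0 h; rewrite leNgt; apply/negP => yx; nra. Qed.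

(** C^Q is viewed as a real Euclidean space: norms and expectations of hermitian operators are real,
    so the real part suffices and no phases have to be tracked. *)
Definition rip Q (u v : Q -> C) : R := Re (\sum_q Num.conj (u q) * v q).

Lemma rip_sym Q (u v : Q -> C) : rip u v = rip v u.
Proof.
rewrite /rip -Re_conj rmorph_sum; congr Re; apply: eq_bigr => q _.
by rewrite rmorphM /= conjCK mulrC.
Qed.

Lemma ripDr Q (u v w : Q -> C) (a : R) :
  rip u (fun q => rc a * v q + w q) = a * rip u v + rip u w.
Proof.
rewrite /rip -Re_rc -ReD; congr Re; rewrite mulr_sumr -big_split /=.
by apply: eq_bigr => q _; ring.
Qed.

Lemma rip_rn Q (u : Q -> C) : rc (rip u u) = \sum_q Num.conj (u q) * u q.
Proof.
apply: RRe_real; apply: ger0_real; apply: sumr_ge0 => q _; exact: normCK_ge0.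
Qed.

Lemma rn_ge0 Q (u : Q -> C) : 0 <= rip u u.
Proof. by rewrite -ler0c rip_rn; apply: sumr_ge0 => q _; exact: normCK_ge0. Qed.

Lemma rn0 Q (u : Q -> C) : rip u u = 0 -> forall q, u q = 0.
Proof.
move=> h q; have := rip_rn u; rewrite h => /esym/eqP.
rewrite psumr_eq0 => [/allP/(_ q)|x _]; last exact: normCK_ge0.
by rewrite mem_index_enum mulrC mul_conjC_eq0 => /(_ isT)/eqP.
Qed.

Lemma cauchy_schwarz Q (u v : Q -> C) : rip u v ^+ 2 <= rip u u * rip v v.
Proof.
have [v0|v0] := eqVneq (rip v v) 0.
  have -> : rip u v = 0 by rewrite /rip big1 // => q _; rewrite (rn0 v0) mulr0.
  by rewrite v0 expr0n mulr0.
have vp : 0 < rip v v by rewrite lt_def v0 rn_ge0.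
(* This value of a minimises the squared norm of a v + u. *)
pose a := - rip u v / rip v v.
have := rn_ge0 (fun q => rc a * v q + u q).
rewrite ripDr !(rip_sym (fun q => rc a * v q + u q)) !ripDr (rip_sym v u).
have -> : a * (a * rip v v + rip u v) + (a * rip u v + rip u u) =
   (rip u u * rip v v - rip u v ^+ 2) / rip v v by rewrite /a; field.
by rewrite pmulr_lge0 ?invr_gt0 // subr_ge0.
Qed.

(** The operator t^2 1 - H^2 has the nonnegative spectrum t^2 - f^2, so its quadratic form at v is
    nonnegative. *)
Lemma fcal_bound S (U : op R S S) (f : S -> R) (t : R) (v : S -> C) :
  qunitary U -> (forall k, `|f k| <= t) ->
  rip (fun s => \sum_s' fcal U f s s' * v s') (fun s => \sum_s' fcal U f s s' * v s')
    <= t ^+ 2 * rip v v.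
Proof.
move=> Uu ft.
have [] := @fcal_psd R S U (fun k => t ^+ 2 + - (f k * f k)) _.
  move=> k; rewrite subr_ge0 -expr2 -(real_normK (num_real (f k))) lerXn2r // ?nnegrE //.
  exact: le_trans (ft k).
move=> _ /(_ v).
have -> : fcal U (fun k => t ^+ 2 + - (f k * f k)) =
  opadd (opscale (rc (t ^+ 2)) (@op1 R S)) (opscale (- 1) (opmul (fcal U f) (fcal U f))).
  rewrite fcal_mul // -(fcal_cst _ Uu) -fcalD; congr opadd.
  apply: op_ext => i j; rewrite /fcal /opscale mulr_sumr.
  by apply: eq_bigr => k _; rewrite rmorphN /=; ring.
have -> : \sum_i \sum_j Num.conj (v i) *
   opadd (opscale (rc (t ^+ 2)) (@op1 R S)) (opscale (- 1) (opmul (fcal U f) (fcal U f))) i j * v j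
  = rc (t ^+ 2 * rip v v - rip (fun s => \sum_s' fcal U f s s' * v s') (fun s => \sum_s' fcal U f s s' * v s')).
  rewrite rmorphB [in RHS]rmorphM /= !rip_rn mulr_sumr.
  transitivity (\sum_i \sum_j Num.conj (v i) * (rc (t ^+ 2) * (i == j)%:R) * v j
     - \sum_i \sum_j Num.conj (v i) * opmul (fcal U f) (fcal U f) i j * v j).
    rewrite -sumrB; apply: eq_bigr => i _; rewrite -sumrB; apply: eq_bigr => j _.
    by rewrite /opadd /opscale /op1; ring.
  congr (_ - _).
    apply: eq_bigr => i _; rewrite (bigD1 i) //= eqxx big1 ?addr0; first by rewrite /=; ring.
    by move=> j ji; rewrite eq_sym (negPf ji) /=; ring.
  transitivity (\sum_i \sum_j \sum_k Num.conj (v i) * fcal U f i k * fcal U f k j * v j).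
    apply: eq_bigr => i _; apply: eq_bigr => j _.
    by rewrite /opmul mulr_sumr mulr_suml; apply: eq_bigr => k _; ring.
  under eq_bigr do rewrite exchange_big /=.
  rewrite exchange_big /=; apply: eq_bigr => k _.
  rewrite rmorph_sum /= mulr_suml; apply: eq_bigr => i _.
  rewrite [RHS]mulr_sumr.
apply: eq_bigr => j _.
  by rewrite rmorphM /= -[Num.conj (fcal U f k i)]/(qadj (fcal U f) i k) fcal_herm; ring.
by rewrite ler0c subr_ge0.
Qed.

(** The operator 1 ⊗ H; the factor [P] collects the registers that the observable does not touch. *)
Definition onsnd P S (H : op R S S) (u : P * S -> C) : P * S -> C :=
  fun q => \sum_s H q.2 s * u (q.1, s).

Lemma onsndD P S (H : op R S S) (u v : P * S -> C) (a : C) :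
  onsnd H (fun q => a * u q + v q) = fun q => a * onsnd H u q + onsnd H v q.
Proof.
apply: funext => q; rewrite /onsnd mulr_sumr -big_split /=.
by apply: eq_bigr => s _; ring.
Qed.

Lemma onsnd_herm P S (H : op R S S) (u v : P * S -> C) : qhermitian H ->
  rip u (onsnd H v) = rip (onsnd H u) v.
Proof.
move=> hH; rewrite /rip /onsnd; congr Re.
rewrite (eq_bigr (fun q : P * S => \sum_s Num.conj (u (q.1, q.2)) * H q.2 s * v (q.1, s))); last first.
  by move=> [p s] _ /=; rewrite mulr_sumr; apply: eq_bigr => s' _; ring.
rewrite [RHS](eq_bigr (fun q : P * S => \sum_s Num.conj (u (q.1, s)) * H s q.2 * v (q.1, q.2))); last first.
  move=> [p s] _ /=; rewrite rmorph_sum mulr_suml; apply: eq_bigr => s' _.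
  by rewrite rmorphM /= -[Num.conj (H s s')]/(qadj H s' s) hH; ring.
rewrite -(pair_bigA _ (fun p s' => \sum_s Num.conj (u (p, s')) * H s' s * v (p, s))) /=.
rewrite -(pair_bigA _ (fun p s' => \sum_s Num.conj (u (p, s)) * H s s' * v (p, s'))) /=.
by apply: eq_bigr => p _; rewrite exchange_big.
Qed.

Lemma onsnd_bound P S (U : op R S S) (f : S -> R) (t : R) (u : P * S -> C) :
  qunitary U -> (forall k, `|f k| <= t) ->
  rip (onsnd (fcal U f) u) (onsnd (fcal U f) u) <= t ^+ 2 * rip u u.
Proof.
move=> Uu ft.
rewrite -lecR rmorphM /= !rip_rn.
rewrite (eq_bigr (fun q : P * S => Num.conj (onsnd (fcal U f) u (q.1, q.2)) * onsnd (fcal U f) u (q.1, q.2))); last by case.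
rewrite [in leRHS](eq_bigr (fun q : P * S => Num.conj (u (q.1, q.2)) * u (q.1, q.2))); last by case.
rewrite -(pair_bigA _ (fun p s => Num.conj (onsnd (fcal U f) u (p, s)) * onsnd (fcal U f) u (p, s))) /=.
rewrite -(pair_bigA _ (fun p s => Num.conj (u (p, s)) * u (p, s))) /=.
rewrite mulr_sumr; apply: ler_sum => p _.
have := @fcal_bound S U f t (fun s => u (p, s)) Uu ft.
by rewrite -lecR rmorphM /= !rip_rn.
Qed.

(* With [F = sqrt c] and [u0 / F] the normalised reference vector, expand
   [<u - u0/F, H (u + u0/F)> = <u, H u>] and apply Cauchy-Schwarz. *)
Lemma overlap_bound P S (U : op R S S) (f : S -> R) (t d c : R) (u u0 : P * S -> C) :
  qunitary U -> (forall k, `|f k| <= t) -> 0 <= t -> 0 < d -> 0 <= c ->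
  rip u u = d -> rip u0 u0 = d * c -> rip u0 u = d * c ->
  rip u0 (onsnd (fcal U f) u0) = 0 ->
  c <= 1 /\ rip u (onsnd (fcal U f) u) <= 2 * t * d * Num.sqrt (1 - c).
Proof.
move=> Uu ft t0 d0 c0 uu u00 u0u H0; set H := fcal U f in H0 *.
set z := rip u (onsnd H u).
pose F := Num.sqrt c; have FF : F ^+ 2 = c by rewrite sqr_sqrtr.
have F0 : 0 <= F by exact: sqrtr_ge0.
(* For c = 0 there is no reference direction to normalise, but Cauchy-Schwarz alone gives z <= t d,
   half of the claimed bound. *)
have [c_eq0|c_neq0] := eqVneq c 0.
  rewrite c_eq0 subr0 sqrtr1 mulr1; split; first exact: ler01.
  have : z ^+ 2 <= (t * d) ^+ 2.
    apply: le_trans (cauchy_schwarz _ _) _.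
    rewrite uu exprMn [d ^+ 2]expr2 mulrA [t ^+ 2 * d]mulrC -mulrA ler_pM2l // mulrC.
    by rewrite mulrC; have := onsnd_bound u Uu ft; rewrite uu.
  have td0 : 0 <= t * d by rewrite mulr_ge0 // ltW.
  by move=> /(sqr_le td0); lra.
have Fp : 0 < F by rewrite sqrtr_gt0 lt_def c_neq0.
(* [m] and [w] are -F (u - u0/F) and F (u + u0/F), which avoids dividing by F. In <m, H w> the cross
   terms cancel and leave -c z, while |m|^2 |w|^2 = 4 d^2 c^2 (1 - c). Nonnegativity of |m|^2 also
   yields F <= 1. *)
pose m := fun q => rc (- F) * u q + u0 q.
pose w := fun q => rc F * u q + u0 q.
have mm : rip m m = 2 * d * c * (1 - F).
  by rewrite ripDr !(rip_sym m) !ripDr (rip_sym u u0) uu u00 u0u -FF; ring.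
have ww : rip w w = 2 * d * c * (1 + F).
  by rewrite ripDr !(rip_sym w) !ripDr (rip_sym u u0) uu u00 u0u -FF; ring.
have mw : rip m (onsnd H w) = - (c * z).
  have e1 : rip (onsnd H u) u = z by rewrite rip_sym.
  have e2 : rip (onsnd H u0) u0 = 0 by rewrite rip_sym.
  have e3 : rip (onsnd H u0) u = rip (onsnd H u) u0.
    by rewrite -onsnd_herm 1?rip_sym //; exact: fcal_herm.
  by rewrite onsndD ripDr !(rip_sym m) !ripDr e1 e2 e3 -FF; ring.
have cp : 0 < c by rewrite lt_def c_neq0.
have F1 : F <= 1.
  by have := rn_ge0 m; rewrite mm pmulr_rge0 ?subr_ge0 // !mulr_gt0.
have c1 : c <= 1 by rewrite -FF expr_le1.
split=> //.
have := cauchy_schwarz m (onsnd H w); rewrite mw sqrrN.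
have := onsnd_bound w Uu ft; rewrite -/H ww => h1 h2.
have h3 : (c * z) ^+ 2 <= c ^+ 2 * ((2 * t * d) ^+ 2 * (1 - c)).
  apply: le_trans h2 _.
  have -> : c ^+ 2 * ((2 * t * d) ^+ 2 * (1 - c)) =
    rip m m * (t ^+ 2 * (2 * d * c * (1 + F))) by rewrite mm -FF; ring.
  by apply: ler_wpM2l h1; exact: rn_ge0.
rewrite exprMn ler_pM2l ?exprn_gt0 // in h3.
have s0 : 0 <= 1 - c by rewrite subr_ge0.
have r0 : 0 <= 2 * t * d * Num.sqrt (1 - c).
  by rewrite !mulr_ge0 ?sqrtr_ge0 // ltW.
by apply: (sqr_le r0); rewrite exprMn sqr_sqrtr.
Qed.
End RealInnerProduct.

(** * Kraus representations *)

Section Kraus.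
Variable R : realType.
Local Notation C := (R[i]).
Local Notation rc := (real_complex R).
Implicit Types A B L T J : finType.

Definition kraus A B T (N : T -> op R B A) (M : op R A A -> op R B B) : Prop :=
  forall X b b', M X b b' = \sum_t opmul (opmul (N t) X) (qadj (N t)) b b'.

Definition complete A B T (N : T -> op R B A) : Prop :=
  forall a a', \sum_t opmul (qadj (N t)) (N t) a a' = (a == a')%:R.

Lemma opmul_suml T A B J (N : T -> op R A B) (Y : op R B J) a j :
  opmul (fun a b => \sum_t N t a b) Y a j = \sum_t opmul (N t) Y a j.
Proof.
rewrite /opmul exchange_big /=; apply: eq_bigr => b _.
by rewrite mulr_suml.
Qed.

Lemma opmul_sumr T A B J (Y : op R J A) (N : T -> op R A B) j b :
  opmul Y (fun a b => \sum_t N t a b) j b = \sum_t opmul Y (N t) j b.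
Proof.
rewrite /opmul exchange_big /=; apply: eq_bigr => a _.
by rewrite mulr_sumr.
Qed.

Lemma kraus_comp A B L T J (N : T -> op R B A) (K : J -> op R L B)
    (M : op R A A -> op R B B) (Rc : op R B B -> op R L L) :
  kraus N M -> kraus K Rc ->
  kraus (fun p : J * T => opmul (K p.1) (N p.2)) (Rc \o M).
Proof.
move=> hN hK X l l' /=; rewrite hK.
rewrite -(pair_bigA _ (fun j t => opmul (opmul (opmul (K j) (N t)) X)
   (qadj (opmul (K j) (N t))) l l')) /=.
apply: eq_bigr => j _.
have -> : M X = fun b b' => \sum_t opmul (opmul (N t) X) (qadj (N t)) b b'.
  by apply: op_ext => b b'; exact: hN.
have -> : opmul (K j) (fun b b' => \sum_t opmul (opmul (N t) X) (qadj (N t)) b b') =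
    fun l b' => \sum_t opmul (K j) (opmul (opmul (N t) X) (qadj (N t))) l b'.
  by apply: op_ext => a b; rewrite opmul_sumr.
rewrite opmul_suml; apply: eq_bigr => t _.
by rewrite qadj_mul !opmulA.
Qed.

(** Each Kraus operator contributes the amplitude <phi^|(G_t ⊗ 1)|phi^> = tr G_t / d, so the squared
    fidelity is the sum of |tr G_t|^2 / d^2. *)
Lemma fidelity_kraus L T (G : T -> op R L L) (M : op R L L -> op R L L) (c : R) :
  (0 < #|L|)%N -> kraus G M ->
  rc c = (\sum_t Num.conj (qtr (G t)) * qtr (G t)) / #|L|%:R ^+ 2 ->
  0 <= c /\ fidelity (ext M (@maxent R L)) (@maxent R L) = Num.sqrt c.
Proof.
move=> L0 hG cE; have d0 : (#|L|%:R : C) != 0 by rewrite pnatr_eq0 -lt0n.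
have rhoE l k l' k' : ext M (@maxent R L) (l, k) (l', k') =
    (\sum_t G t l k * Num.conj (G t l' k')) / #|L|%:R.
  rewrite /ext /= hG mulr_suml; apply: eq_bigr => t _.
  rewrite /opmul (bigD1 k') //= [X in _ + X]big1 ?addr0.
    rewrite mulr_suml (bigD1 k) //= big1 ?addr0.
      by rewrite /maxent /= !eqxx /qadj /= mul1r; ring.
    by move=> r rk; rewrite /maxent /= (negPf rk) mul0r mulr0 mul0r.
  move=> r rk; rewrite big1 ?mul0r // => s _.
  by rewrite /maxent /= (negPf rk) andbF mul0r mulr0.
have s0 : 0 <= (#|L|%:R : R)^-1 by rewrite invr_ge0 ler0n.
have prho : psd (ext M (@maxent R L)).
  (* The rows of [S] are the conjugates of the vectors (G_t ⊗ 1)|phi^>, which exhibits the output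
     state as a Gram operator. *)
  pose S : op R T (L * L)%type :=
    fun t p => rc (Num.sqrt (#|L|%:R)^-1) * Num.conj (G t p.1 p.2).
  suff -> : ext M (@maxent R L) = opmul (qadj S) S by exact: psd_gram.
  apply: op_ext => -[l k] [l' k']; rewrite rhoE /opmul mulr_suml; apply: eq_bigr => t _.
  rewrite /qadj /S rmorphM /= conj_rc conjCK.
  transitivity (rc (Num.sqrt (#|L|%:R)^-1 ^+ 2) * (G t l k * Num.conj (G t l' k'))).
    by rewrite sqr_sqrtr // fmorphV /= rmorph_nat mulrC.
  by rewrite rmorphXn /=; ring.
apply: fidelity_maxent => //; rewrite cE.
have -> : \sum_k \sum_l ext M (@maxent R L) (k, k) (l, l) =
    (\sum_t Num.conj (qtr (G t)) * qtr (G t)) / #|L|%:R; last by field.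
under eq_bigr do under eq_bigr do rewrite rhoE.
under eq_bigr do rewrite -mulr_suml.
rewrite -mulr_suml; congr (_ / _).
under eq_bigr do rewrite exchange_big.
rewrite exchange_big; apply: eq_bigr => t _ /=.
rewrite mulrC /qtr mulr_suml; apply: eq_bigr => k _.
by rewrite -mulr_sumr rmorph_sum.
Qed.

Lemma linmap_sum A B (T : eqType) (M : op R A A -> op R B B) (s : seq T) (a : T -> C)
    (Y : T -> op R A A) : linmap M ->
  M (fun i j => \sum_(t <- s) a t * Y t i j) =
  fun i j => \sum_(t <- s) a t * M (Y t) i j.
Proof.
move=> lM; elim: s => [|x s IH].
  (* [linmap] speaks only of combinations a X + Y, so zero is written as (-1) 0 + 0, whose image
     cancels. *)
  have -> : (fun i j : A => \sum_(t <- [::]) a t * Y t i j) = opadd (opscale (-1) (@op0 R A A)) (@op0 R A A).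
    by apply: op_ext => i j; rewrite big_nil /opadd /opscale /op0 mulr0 addr0.
  rewrite lM; apply: op_ext => i j; rewrite big_nil /opadd /opscale; ring.
have -> : (fun i j => \sum_(t <- x :: s) a t * Y t i j) =
    opadd (opscale (a x) (Y x)) (fun i j => \sum_(t <- s) a t * Y t i j).
  by apply: op_ext => i j; rewrite big_cons.
by rewrite lM IH; apply: op_ext => i j; rewrite big_cons.
Qed.

(* The Kraus operators are the columns of a square root of the Choi matrix. *)
Lemma channel_kraus A B (M : op R A A -> op R B B) : channel M ->
  exists (J : finType) (K : J -> op R B A), kraus K M /\ complete K.
Proof.
move=> [lM cpM trM].
pose E (p : A * A) : op R A A := fun i j => ((i == p.1) && (j == p.2))%:R.
have ME X : M X = fun i j => \sum_p X p.1 p.2 * M (E p) i j.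
  rewrite -(linmap_sum _ (fun p => X p.1 p.2) E lM); congr M.
  apply: op_ext => i j; rewrite (bigD1 (i, j)) //= /E /= !eqxx mulr1 big1 ?addr0 //.
  move=> [x y] /=; rewrite xpair_eqE negb_and [i == x]eq_sym [j == y]eq_sym.
  by case: (x == i); case: (y == j) => //= _; rewrite mulr0.
(* [W] is the unnormalised maximally entangled operator, so [ext M W] is the Choi matrix, with the
   matrix-unit images M(E_{aa'}) as its blocks. *)
pose W : op R (A * A)%type (A * A)%type := fun p q => ((p.1 == p.2) && (q.1 == q.2))%:R.
have pW : psd W.
  pose S : op R unit (A * A)%type := fun _ p => (p.1 == p.2)%:R.
  suff -> : W = opmul (qadj S) S by exact: psd_gram.
  apply: op_ext => p q; rewrite /opmul (bigD1 tt) //= big1 ?addr0; last by case.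
  rewrite /qadj /S conjC_nat /W.
  by case: (_ == _); case: (_ == _); rewrite /= ?mulr0 ?mulr1.
have [[hS _] SS] := sqrtmP (cpM _ _ pW).
pose S := sqrtm (ext M W); rewrite -/S in hS SS.
pose K (j : B * A) : op R B A := fun b a => S (b, a) j.
have KE b b' a a' : \sum_j K j b a * Num.conj (K j b' a') = M (E (a, a')) b b'.
  have /(congr1 (fun F => F (b, a) (b', a'))) := SS.
  rewrite /opmul => SSE; rewrite /K.
  transitivity (ext M W (b, a) (b', a')); last by [].
  rewrite -SSE; apply: eq_bigr => j _; congr (_ * _).
  by rewrite -{2}hS.
exists (B * A)%type, K; split.
  move=> X b b'; rewrite ME.
  transitivity (\sum_p \sum_j K j b p.1 * X p.1 p.2 * Num.conj (K j b' p.2)).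
    by apply: eq_bigr => -[a a'] _; rewrite -KE mulr_sumr; apply: eq_bigr => j _ /=; ring.
  rewrite exchange_big; apply: eq_bigr => j _ /=.
  rewrite -(pair_bigA _ (fun x y => K j b x * X x y * Num.conj (K j b' y))) /=.
  rewrite exchange_big /=; rewrite [RHS]/opmul; apply: eq_bigr => a _.
  by rewrite /opmul mulr_suml.
move=> a a'.
(* Completeness is trace preservation tested on matrix units. *)
transitivity (qtr (M (E (a', a)))).
  rewrite /qtr; under [RHS]eq_bigr do rewrite -KE.
  rewrite exchange_big; apply: eq_bigr => j _; rewrite /opmul; apply: eq_bigr => b _.
  by rewrite mulrC.
rewrite trM /qtr (bigD1 a) //= /E /= eqxx big1 ?addr0 ?andbT // => x xa.
by rewrite (negPf xa) andbF.
Qed.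

Lemma kraus_channel A B T (K : T -> op R B A) (M : op R A A -> op R B B) :
  kraus K M -> complete K -> channel M.
Proof.
move=> hK cK; split.
- move=> a X Y; apply: op_ext => b b'; rewrite /opadd /opscale !hK mulr_sumr -big_split.
  by apply: eq_bigr => t _; rewrite opmulDr opmulDl opmulZr opmulZl.
- move=> J X [hX pX].
  have extE p q : ext M X p q = \sum_t \sum_a \sum_a'
     K t p.1 a * X (a, p.2) (a', q.2) * Num.conj (K t q.1 a').
    rewrite /ext hK; apply: eq_bigr => t _; rewrite exchange_big /= [LHS]/opmul.
    by apply: eq_bigr => a' _; rewrite /opmul mulr_suml.
  split.
    apply: op_ext => p q; rewrite /qadj !extE rmorph_sum; apply: eq_bigr => t _.
    rewrite rmorph_sum exchange_big; apply: eq_bigr => a _ /=.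
    rewrite rmorph_sum; apply: eq_bigr => a' _ /=.
    rewrite !rmorphM /= conjCK -[Num.conj (X _ _)]/(qadj X _ _) hX; ring.
  move=> v.
  (* [w t] is (K_t^* ⊗ 1) v: the quadratic form of the output at v is the sum of those of X at the
     [w t]. *)
  pose w t (s : A * J) := \sum_b Num.conj (K t b s.1) * v (b, s.2).
  suff -> : \sum_p \sum_q Num.conj (v p) * ext M X p q * v q =
     \sum_t \sum_s \sum_s' Num.conj (w t s) * X s s' * w t s'.
    by apply: sumr_ge0 => t _; exact: pX.
  have pairE (F : B * J -> C) : \sum_p F p = \sum_j \sum_b F (b, j).
    by rewrite exchange_big pair_bigA; apply: eq_bigr => -[].
  have pairE' (F : A * J -> C) : \sum_p F p = \sum_j \sum_b F (b, j).
    by rewrite exchange_big pair_bigA; apply: eq_bigr => -[].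
  transitivity (\sum_t \sum_p \sum_q \sum_a \sum_a'
     Num.conj (v p) * (K t p.1 a * X (a, p.2) (a', q.2) * Num.conj (K t q.1 a')) * v q).
    rewrite [RHS]exchange_big; apply: eq_bigr => p _.
    rewrite [RHS]exchange_big; apply: eq_bigr => q _.
    rewrite extE mulr_sumr mulr_suml; apply: eq_bigr => t _.
    rewrite mulr_sumr mulr_suml; apply: eq_bigr => a _.
    by rewrite mulr_sumr mulr_suml; apply: eq_bigr => a' _.
  apply: eq_bigr => t _.
  rewrite pairE pairE'; apply: eq_bigr => j _.
  transitivity (\sum_b \sum_a \sum_j' \sum_b' \sum_a'
    Num.conj (v (b, j)) * (K t b a * X (a, j) (a', j') * Num.conj (K t b' a')) * v (b', j')).
    apply: eq_bigr => b _; rewrite pairE.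
    rewrite [RHS]exchange_big; apply: eq_bigr => j' _.
    rewrite [RHS]exchange_big; apply: eq_bigr => b' _ //.
  rewrite exchange_big; apply: eq_bigr => a _.
  rewrite pairE'.
  rewrite exchange_big; apply: eq_bigr => j' _ /=.
  under eq_bigr do rewrite exchange_big /=.
  rewrite exchange_big; apply: eq_bigr => a' _ /=.
  rewrite /w /= rmorph_sum !mulr_suml; apply: eq_bigr => b _.
  rewrite mulr_sumr; apply: eq_bigr => b' _.
  by rewrite rmorphM /= conjCK; ring.
- move=> X; rewrite /qtr; under eq_bigr do rewrite hK.
  rewrite exchange_big /=.
  transitivity (\sum_t qtr (opmul (opmul (qadj (K t)) (K t)) X)).
    apply: eq_bigr => t _.
    by have := qtrC (opmul (K t) X) (qadj (K t)); rewrite opmulA => <-.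
  rewrite /qtr.
  rewrite exchange_big; apply: eq_bigr => a _ /=.
  under eq_bigr do rewrite /opmul.
  rewrite exchange_big (bigD1 a) //= [X in _ + X]big1 ?addr0.
    by rewrite -mulr_suml (cK a a) eqxx mul1r.
  by move=> a' aa'; rewrite -mulr_suml (cK a a') eq_sym (negPf aa') mul0r.
Qed.

(** Discard the input and prepare a fixed basis state, with Kraus operators |l0><b|. This makes the
    set of fidelities under the supremum in [fe] nonempty. *)
Lemma channel_exists B L : (0 < #|L|)%N -> exists M : op R B B -> op R L L, channel M.
Proof.
move=> /card_gt0P[l0 _].
pose K (b : B) : op R L B := fun l b' => ((l == l0) && (b' == b))%:R.
exists (fun X l l' => \sum_t opmul (opmul (K t) X) (qadj (K t)) l l').
apply: (@kraus_channel _ _ _ K) => // b b'.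
rewrite (bigD1 b) //= [X in _ + X]big1 ?addr0.
  rewrite /opmul (bigD1 l0) //= [X in _ + X]big1 ?addr0.
    by rewrite /qadj /K !eqxx conjC_nat mul1r /= eq_sym.
  by move=> l ll; rewrite /K (negPf ll) mulr0.
move=> t tb; rewrite /opmul big1 // => l _; rewrite /qadj /K [b == t]eq_sym (negPf tb) andbF.
by rewrite conjC0 mul0r.
Qed.
End Kraus.

(** * The observable on site and reference *)

Section Core.
Variable R : realType.
Local Notation C := (R[i]).
Local Notation rc := (real_complex R).
Local Notation Re := (@complex.Re R).
Implicit Types A B L T J X : finType.

Definition tensop X L (U : op R X X) (W : op R L L) : op R (X * L)%type (X * L)%type :=
  fun p q => U p.1 q.1 * W p.2 q.2.

Lemma tensop_sum X L (F : X -> C) (H : L -> C) :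
  \sum_(p : X * L) F p.1 * H p.2 = (\sum_x F x) * \sum_l H l.
Proof.
rewrite -(pair_bigA _ (fun x l => F x * H l)) /= mulr_suml.
by apply: eq_bigr => x _; rewrite mulr_sumr.
Qed.

Lemma tensop_unitary X L (U : op R X X) (W : op R L L) :
  qunitary U -> qunitary W -> qunitary (tensop U W).
Proof.
have e X' L' (U1 U2 : op R X' X') (W1 W2 : op R L' L') :
    opmul (tensop U1 W1) (tensop U2 W2) = tensop (opmul U1 U2) (opmul W1 W2).
  apply: op_ext => p q; rewrite /opmul /tensop -tensop_sum.
  by apply: eq_bigr => s _ /=; ring.
have a X' L' (U1 : op R X' X') (W1 : op R L' L') :
    qadj (tensop U1 W1) = tensop (qadj U1) (qadj W1).
  by apply: op_ext => p q; rewrite /qadj /tensop rmorphM.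
have o : tensop (@op1 R X) (@op1 R L) = @op1 R (X * L)%type.
  apply: op_ext => -[x l] [y m]; rewrite /tensop /op1 /= xpair_eqE.
  by case: (x == y); case: (l == m) => /=; rewrite ?mulr0 ?mulr1.
by move=> [U1 U2] [W1 W2]; split; rewrite a e ?U1 ?U2 ?W1 ?W2 o.
Qed.

Lemma fcal_tensop X L (U : op R X X) (W : op R L L) f g :
  fcal (tensop U W) (fun p => f p.1 * g p.2) = tensop (fcal U f) (fcal W g).
Proof.
apply: op_ext => p q; rewrite /tensop /fcal -tensop_sum; apply: eq_bigr => s _ /=.
by rewrite !rmorphM /=; ring.
Qed.

(** Conjugating the eigenvectors transposes the operator. The reference register must carry the
    transpose of Z, because 1 ⊗ Z^T acts on a vectorised operator as right multiplication by Z. *)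
Lemma fcal_conj L (W : op R L L) g r r' :
  fcal (fun i j => Num.conj (W i j)) g r r' = fcal W g r' r.
Proof. by rewrite /fcal; apply: eq_bigr => k _; rewrite conjCK; ring. Qed.

Lemma qunitary_conj L (W : op R L L) :
  qunitary W -> qunitary (fun i j => Num.conj (W i j)).
Proof.
move=> [W1 W2]; split; apply: op_ext => i j; rewrite /opmul /qadj.
  rewrite -[LHS]conjCK rmorph_sum /=.
  have -> : \sum_k Num.conj (Num.conj (Num.conj (W k i)) * Num.conj (W k j)) = opmul (qadj W) W i j.
    by apply: eq_bigr => k _; rewrite rmorphM /= !conjCK.
  by rewrite W1 /op1 conjC_nat.
rewrite -[LHS]conjCK rmorph_sum /=.
have -> : \sum_k Num.conj (Num.conj (W i k) * Num.conj (Num.conj (W j k))) = opmul W (qadj W) i j.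
  by apply: eq_bigr => k _; rewrite rmorphM /= !conjCK.
by rewrite W2 /op1 conjC_nat.
Qed.

(** The squared entanglement fidelity of the map with Kraus family [G], by [fidelity_kraus]. *)
Definition efid L T (G : T -> op R L L) : R :=
  rip (fun t => qtr (G t)) (fun t => qtr (G t)) / #|L|%:R ^+ 2.

Lemma efidE L T (G : T -> op R L L) :
  rc (efid G) = (\sum_t Num.conj (qtr (G t)) * qtr (G t)) / #|L|%:R ^+ 2.
Proof. by rewrite /efid fmorph_div /= rip_rn rmorphXn rmorph_nat. Qed.

Lemma efid_ge0 L T (G : T -> op R L L) : 0 <= efid G.
Proof. by rewrite /efid mulr_ge0 ?rn_ge0 ?invr_ge0 ?exprn_ge0 ?ler0n. Qed.

(** This is [overlap_bound] for the vectorised family [G]: the Kraus label j and the output index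
    are spectators, and the observable T ⊗ Z^T acts on the erased register x and the reference. *)
Lemma family_bound J X L (U : op R X X) (f : X -> R) (t : R) (W : op R L L) (g : L -> R)
    (G : J * X -> op R L L) :
  (0 < #|L|)%N -> qunitary U -> qunitary W -> (forall k, `|f k| <= t) -> 0 <= t ->
  (forall k, `|g k| <= 1) -> \sum_k g k = 0 ->
  \sum_p qtr (opmul (qadj (G p)) (G p)) = #|L|%:R ->
  efid G <= 1 /\
  Re (\sum_x \sum_y fcal U f x y *
        \sum_j qtr (opmul (opmul (qadj (G (j, x))) (G (j, y))) (fcal W g)))
    <= 2 * t * #|L|%:R * Num.sqrt (1 - efid G).
Proof.
move=> L0 Uu Wu ft t0 g1 gs nG.
have d0 : (#|L|%:R : C) != 0 by rewrite pnatr_eq0 -lt0n.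
have dR : 0 < (#|L|%:R : R) by rewrite ltr0n.
pose Wc : op R L L := fun i j => Num.conj (W i j).
have Wcu : qunitary Wc by exact: qunitary_conj.
pose u (s : (J * L) * (X * L)) := G (s.1.1, s.2.1) s.1.2 s.2.2.
(* a_p 1 is the component of G_p along the identity, so [u0] is the orthogonal projection of [u] and
   both <u0, u0> and <u0, u> equal d times [efid G]. *)
pose a p := qtr (G p) / #|L|%:R.
pose u0 (s : (J * L) * (X * L)) := a (s.1.1, s.2.1) * (s.1.2 == s.2.2)%:R.
have sumQ (F : (J * L) * (X * L) -> C) :
    \sum_s F s = \sum_j \sum_x \sum_l \sum_r F ((j, l), (x, r)).
  rewrite (eq_bigr (fun s => F (s.1, s.2))); last by case.
  rewrite -(pair_bigA _ (fun p q => F (p, q))) /=.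
  rewrite (eq_bigr (fun p : J * L => \sum_q F ((p.1, p.2), q))); last by case.
  rewrite -(pair_bigA _ (fun j l => \sum_q F ((j, l), q))) /=.
  apply: eq_bigr => j _; rewrite [RHS]exchange_big; apply: eq_bigr => l _ /=.
  rewrite (eq_bigr (fun q : X * L => F ((j, l), (q.1, q.2)))); last by case.
  by rewrite -(pair_bigA _ (fun x r => F ((j, l), (x, r)))).
have sumJX (F : J * X -> C) : \sum_p F p = \sum_j \sum_x F (j, x).
  rewrite (eq_bigr (fun p => F (p.1, p.2))); last by case.
  by rewrite -(pair_bigA _ (fun p q => F (p, q))).
have dl (l : L) (F : L -> C) : \sum_r (l == r)%:R * F r = F l.
  rewrite (bigD1 l) //= eqxx mul1r big1 ?addr0 // => r rl.
  by rewrite eq_sym (negPf rl) mul0r.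
have := @overlap_bound R (J * L)%type (X * L)%type (tensop U Wc)
  (fun p => f p.1 * g p.2) t #|L|%:R (efid G) u u0 (tensop_unitary Uu Wcu).
rewrite fcal_tensop.
case.
- move=> k; rewrite normrM -[t]mulr1; apply: ler_pM => //.
- exact: t0.
- exact: dR.
- exact: efid_ge0.
- apply: complexI; rewrite rip_rn sumQ rmorph_nat -nG sumJX.
  apply: eq_bigr => j _; apply: eq_bigr => x _.
  by rewrite exchange_big.
- apply: complexI; rewrite rip_rn rmorphM /= efidE rmorph_nat sumQ sumJX mulrA mulr_sumr mulr_suml.
  apply: eq_bigr => j _; rewrite mulr_sumr mulr_suml; apply: eq_bigr => x _.
  transitivity (\sum_(l : L) Num.conj (a (j, x)) * a (j, x)).
    apply: eq_bigr => l _; rewrite -[RHS](dl l (fun=> Num.conj (a (j, x)) * a (j, x))).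
    apply: eq_bigr => r _; rewrite /u0 /= rmorphM /= conjC_nat.
    by case: (l == r) => /=; ring.
  rewrite sumr_const -mulr_natl /a fmorph_div /= conjC_nat; by field.
- rewrite /rip; have -> : \sum_q Num.conj (u0 q) * u q = rc (#|L|%:R * efid G); last by [].
  rewrite rmorphM /= efidE rmorph_nat sumQ sumJX mulrA mulr_sumr mulr_suml.
  apply: eq_bigr => j _; rewrite mulr_sumr mulr_suml; apply: eq_bigr => x _.
  transitivity (\sum_(l : L) Num.conj (a (j, x)) * G (j, x) l l).
    apply: eq_bigr => l _; rewrite -[RHS](dl l (fun r => Num.conj (a (j, x)) * G (j, x) l r)).
    apply: eq_bigr => r _; rewrite /u0 /u /= rmorphM /= conjC_nat; by ring.
  rewrite -mulr_sumr -/(qtr _) /a fmorph_div /= conjC_nat; by field.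
(* In [u0] the output and reference are maximally entangled, so the expectation contains the factor
   tr Z = 0. *)
- rewrite /rip sumQ big1 // => j _; rewrite big1 // => x _.
  transitivity (\sum_(l : L) \sum_y Num.conj (a (j, x)) * fcal U f x y * a (j, y) * fcal W g l l).
    apply: eq_bigr => l _.
    transitivity (\sum_r (l == r)%:R * (Num.conj (a (j, x)) * onsnd (tensop (fcal U f) (fcal Wc g)) u0 ((j, l), (x, r)))).
      by apply: eq_bigr => r _; rewrite {1}/u0 /= rmorphM /= conjC_nat; ring.
    rewrite dl /onsnd mulr_sumr /=.
    rewrite -(pair_bigA _ (fun y r => Num.conj (a (j, x)) * (tensop (fcal U f) (fcal Wc g) (x, l) (y, r) * u0 ((j, l), (y, r))))) /=.
    apply: eq_bigr => y _.
    rewrite -[RHS](dl l (fun r => Num.conj (a (j, x)) * fcal U f x y * a (j, y) * fcal W g r l)).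
    by apply: eq_bigr => r _; rewrite /tensop /u0 /= fcal_conj; ring.
  rewrite exchange_big big1 // => y _; rewrite -mulr_sumr.
  by rewrite -[X in _ * X]/(qtr (fcal W g)) qtr_fcal // gs mulr0.
move=> c1 h; split=> //; apply: le_trans h; rewrite /rip.
suff -> : \sum_q Num.conj (u q) * onsnd (tensop (fcal U f) (fcal Wc g)) u q =
   \sum_x \sum_y fcal U f x y *
        \sum_j qtr (opmul (opmul (qadj (G (j, x))) (G (j, y))) (fcal W g)) by [].
rewrite sumQ exchange_big; apply: eq_bigr => x _ /=.
under [RHS]eq_bigr do rewrite mulr_sumr.
rewrite [RHS]exchange_big; apply: eq_bigr => j _ /=.
transitivity (\sum_l \sum_r \sum_y \sum_r' Num.conj (G (j, x) l r) *
   (fcal U f x y * (fcal W g r' r * G (j, y) l r'))).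
  apply: eq_bigr => l _; apply: eq_bigr => r _; rewrite /onsnd mulr_sumr.
  rewrite [RHS](pair_bigA _ (fun y r' => Num.conj (G (j, x) l r) *
   (fcal U f x y * (fcal W g r' r * G (j, y) l r')))) /=.
  apply: eq_bigr => -[y r'] _; rewrite /tensop /u /= fcal_conj; ring.
move: (fcal U f) (fcal W g) => TT ZZ.
under [LHS]eq_bigr do rewrite exchange_big /=.
rewrite exchange_big; apply: eq_bigr => y _ /=.
rewrite exchange_big /qtr mulr_sumr; apply: eq_bigr => r _ /=.
rewrite exchange_big [in RHS]/opmul mulr_sumr; apply: eq_bigr => r' _ /=.
rewrite mulr_suml mulr_sumr; apply: eq_bigr => l _.
by rewrite /qadj; ring.
Qed.
End Core.

(** * Spread, sign operator, local erasures *)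

Section Bounds.
Variable R : realType.
Local Notation C := (R[i]).
Local Notation rc := (real_complex R).
Local Notation Re := (@complex.Re R).
Implicit Types A B L J X : finType.

(** For w > 0 the bound inverts to x <= sqrt(1 - (w/a)^2), an upper bound on [S] that passes to the
    supremum and is then inverted back. *)
Lemma bound_sqrt_sup (S : set R) (w a : R) : 0 <= a -> (S !=set0)%classic ->
  (forall x, S x -> [/\ 0 <= x, x <= 1 & w <= a * Num.sqrt (1 - x ^+ 2)]) ->
  w <= a * Num.sqrt (1 - sup S ^+ 2).
Proof.
move=> a0 S0 hS; have [w0|wp] := leP w 0.
  by apply: le_trans w0 _; rewrite mulr_ge0 ?sqrtr_ge0.
have [x0 Sx0] := S0.
have ap : 0 < a.
  rewrite lt_def a0 andbT; apply/eqP => a00.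
  by have [_ _] := hS _ Sx0; rewrite a00 mul0r leNgt wp.
pose v := w / a; have vp : 0 < v by rewrite divr_gt0.
have hv x : S x -> v ^+ 2 <= 1 - x ^+ 2.
  move=> /hS[x_ge0 x1]; rewrite mulrC -ler_pdivrMr // -/v => h.
  have h0 : 0 <= 1 - x ^+ 2 by nra.
  by rewrite -(sqr_sqrtr h0) lerXn2r // ?nnegrE ?sqrtr_ge0 ?(ltW vp).
have v1 : 0 <= 1 - v ^+ 2 by have := hv _ Sx0; nra.
have s1 : sup S <= Num.sqrt (1 - v ^+ 2).
  apply: ge_sup => // x Sx; have [x_ge0 _ _] := hS _ Sx.
  by apply: sqr_le; rewrite ?sqrtr_ge0 // sqr_sqrtr //; have := hv _ Sx; lra.
have s0 : 0 <= sup S.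
  have [x_ge0 _ _] := hS _ Sx0; apply: le_trans x_ge0 _; apply: ub_le_sup => //.
  by exists 1 => x /hS[].
have s2 : sup S ^+ 2 <= 1 - v ^+ 2.
  by rewrite -(sqr_sqrtr v1) lerXn2r // ?nnegrE ?sqrtr_ge0.
rewrite mulrC -ler_pdivrMr // -/v -[v]ger0_norm ?(ltW vp) // -sqrtr_sqr ler_sqrt; nra.
Qed.

(** The eigenvalues are exactly the values of [f], so the midpoint of their infimum and supremum
    serves as [m]. It is the constant subtracted from T_i to reach norm at most half the spread. *)
Lemma spread_fcal X (U : op R X X) (f : X -> R) (x0 : X) : qunitary U ->
  0 <= spread (fcal U f) /\
  exists m, forall k, `|f k - m| <= spread (fcal U f) / 2.
Proof.
move=> Uu; set E := eigenvalues (fcal U f).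
have Ef k : E (f k).
  exists (fun i => U i k); split; last first.
    by move=> i; have := fcal_mulU f i k Uu; rewrite /opmul => ->; rewrite mulrC.
  apply: contrapT => h; have := congr1 (fun F => F k k) Uu.1.
  rewrite /opmul big1 => [|i _].
    by rewrite /op1 eqxx => /eqP; rewrite eq_sym oner_eq0.
  have [-> |Ui] := eqVneq (U i k) 0; first by rewrite mulr0.
  by case: h; exists i.
have Einv x : E x -> exists k, x = f k.
  move=> [v [[i vi] hv]].
  (* The coordinates of the eigenvector v in the eigenbasis; one of them is nonzero, and there f k =
     x. *)
  pose w k := \sum_i Num.conj (U i k) * v i.
  have fw k : rc (f k) * w k = rc x * w k.
    rewrite /w !mulr_sumr.
    transitivity (\sum_i Num.conj (U i k) * \sum_j fcal U f i j * v j); last first.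
      by apply: eq_bigr => j _; rewrite hv; ring.
    under [RHS]eq_bigr do rewrite mulr_sumr.
    rewrite exchange_big; apply: eq_bigr => j _ /=.
    transitivity (Num.conj (opmul (fcal U f) U j k) * v j).
      by rewrite fcal_mulU // rmorphM /= conj_rc; ring.
    rewrite /opmul rmorph_sum mulr_suml; apply: eq_bigr => l _.
    by rewrite rmorphM /= -[Num.conj (fcal U f j l)]/(qadj (fcal U f) l j) fcal_herm; ring.
  have [k wk] : exists k, w k != 0.
    apply: contrapT => h; have w0 k : w k = 0.
      by apply/eqP/negPn/negP => wk; apply: h; exists k.
    move/eqP: vi; apply.
    transitivity (\sum_j opmul U (qadj U) i j * v j).
      rewrite Uu.2 (bigD1 i) //= /op1 eqxx mul1r big1 ?addr0 // => j ji.
      by rewrite eq_sym (negPf ji) mul0r.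
    transitivity (\sum_k U i k * w k); last by rewrite big1 // => k _; rewrite w0 mulr0.
    rewrite /w; under [RHS]eq_bigr do rewrite mulr_sumr.
    rewrite [RHS]exchange_big; apply: eq_bigr => j _ /=.
    by rewrite /opmul mulr_suml; apply: eq_bigr => k _; rewrite /qadj; ring.
  by exists k; apply: complexI; apply: (mulIf wk); rewrite fw.
have fle k : `|f k| <= \sum_k `|f k|.
  by rewrite (bigD1 k) //= lerDl sumr_ge0.
have Eub : has_ubound E.
  by exists (\sum_k `|f k|) => x /Einv[k ->]; apply: le_trans (fle k); exact: ler_norm.
have Elb : has_lbound E.
  exists (- \sum_k `|f k|) => x /Einv[k ->]; rewrite lerNl; apply: le_trans (fle k).
  by rewrite -normrN; exact: ler_norm.
have fs k : f k <= sup E by apply: ub_le_sup.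
have fi k : inf E <= f k by apply: ge_inf.
rewrite /spread -/E; split; first by have := fs x0; have := fi x0; lra.
exists ((sup E + inf E) / 2) => k; have := fs k; have := fi k.
by rewrite ler_norml => h1 h2; apply/andP; split; lra.
Qed.

(* The witness is the indicator of [0 < h], recentred to sum to zero. *)
Lemma traceless_sign L (W : op R L L) (h : L -> R) : (0 < #|L|)%N ->
  qunitary W -> \sum_k h k = 0 ->
  exists g : L -> R, [/\ (forall k, `|g k| <= 1), \sum_k g k = 0 &
    qtr (opmul (fcal W h) (fcal W g)) = rc (tnorm (fcal W h) / 2)].
Proof.
move=> L0 Wu h0.
have dp : 0 < (#|L|%:R : R) by rewrite ltr0n.
pose p k : R := (0 < h k)%R%:R.
pose t := (\sum_k p k) / #|L|%:R.
have p01 k : 0 <= p k <= 1 by rewrite /p ler0n; case: (0 < h k)%R; rewrite /= ?lexx ?ler01.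
have t0 : 0 <= t.
  by rewrite divr_ge0 ?ler0n // sumr_ge0 // => k _; case/andP: (p01 k).
have t1 : t <= 1.
  rewrite ler_pdivrMr // mul1r -sumr_const; apply: ler_sum => k _.
  by case/andP: (p01 k).
exists (fun k => p k - t); split.
- by move=> k; rewrite ler_norml; case/andP: (p01 k) => *; apply/andP; split; lra.
- by rewrite sumrB sumr_const -[t *+ _]mulr_natr divfK ?subrr // gt_eqF.
rewrite fcal_mul // qtr_fcal // tnorm_fcal //; congr rc.
(* Pointwise h (p - t) = |h|/2 + h (1/2 - t), and the second term sums to zero with h. *)
transitivity (\sum_k (`|h k| / 2 + h k * (1 / 2 - t))).
  apply: eq_bigr => k _; rewrite /p; have [hk|hk] := ltP 0 (h k).
    by rewrite (gtr0_norm hk) /=; field.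
  by rewrite (ler0_norm hk) /=; field.
by rewrite big_split /= -!mulr_suml h0 mul0r addr0.
Qed.

Section Tensor.
Variables (n : nat) (Ai : 'I_n -> finType).
Implicit Types a b : tensT Ai.

Lemma upd_same a i (x : Ai i) : upd a x i = x.
Proof. by rewrite /upd ffunE dfwith_in. Qed.

Lemma upd_other a i (x : Ai i) j : j != i -> upd a x j = a j.
Proof. by move=> ji; rewrite /upd ffunE dfwith_out // eq_sym. Qed.

Lemma updP a b i : (forall j, j != i -> a j = b j) -> a i = b i -> a = b.
Proof.
move=> h hi; apply/ffunP => j; have [->//|ji] := eqVneq j i.
exact: h.
Qed.

Lemma upd_upd a i (x y : Ai i) : upd (upd a x) y = upd a y.
Proof.
apply: (@updP _ _ i) => [j ji|]; by rewrite ?upd_same ?upd_other.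
Qed.

Lemma upd_id a i : upd a (a i) = a.
Proof. by apply: (@updP _ _ i) => [j ji|]; rewrite ?upd_same ?upd_other. Qed.

(** Exchanging the i-th coordinate of a with x is an involution on the pairs (a, x), and it
    decouples the weight [w] from [h]. *)
Lemma sum_upd i (w : Ai i -> C) (h : tensT Ai -> C) :
  \sum_(a : tensT Ai) w (a i) * (\sum_(x : Ai i) h (upd a x)) = (\sum_x w x) * \sum_a h a.
Proof.
under eq_bigr do rewrite mulr_sumr.
rewrite mulrC mulr_suml; under [RHS]eq_bigr do rewrite mulr_sumr.
rewrite !pair_bigA /=.
pose s (q : tensT Ai * Ai i) := (upd q.1 q.2, q.1 i).
have sK : involutive s.
  by move=> [a x]; rewrite /s /= upd_same upd_upd upd_id.
rewrite (reindex_inj (inv_inj sK)) /=; apply: eq_bigr => -[a x] _ /=.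
by rewrite upd_same upd_upd upd_id mulrC.
Qed.

Definition site_op i (T : op R (Ai i) (Ai i)) : op R (tensT Ai) (tensT Ai) :=
  fun a a' => T (a i) (a' i) * [forall j, (j != i) ==> (a j == a' j)]%:R.

Lemma site_op_sum i (T : op R (Ai i) (Ai i)) a (F : tensT Ai -> C) :
  \sum_a' site_op T a a' * F a' = \sum_y T (a i) y * F (@upd _ Ai a i y).
Proof.
have agree (a' : tensT Ai) : [forall j, (j != i) ==> (a j == a' j)] = (upd a (a' i) == a').
  apply/forallP/eqP => [h|h j].
    apply: (@updP _ _ i) => [j ji|]; last by rewrite upd_same.
    by rewrite upd_other //; have /implyP/(_ ji)/eqP := h j.
  by apply/implyP => ji; rewrite -h upd_other.
rewrite (bigID (fun a' : tensT Ai => upd a (a' i) == a')) /= [X in _ + X]big1 ?addr0; last first.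
  by move=> a' na; rewrite /site_op agree (negPf na) mulr0 mul0r.
rewrite (reindex_onto (fun y : Ai i => upd a y) (fun a' : tensT Ai => a' i)) /=; last first.
  by move=> a' /eqP.
apply: eq_big => [y|y _]; first by rewrite upd_same !eqxx.
by rewrite /site_op agree !upd_same eqxx mulr1.
Qed.

(** The operator N_x = (|phi><x| ⊗ 1) V, where |phi><x| acts on site i. *)
Definition erasure_kraus L (V : op R (tensT Ai) L) i (phi : Ai i -> C) (x : Ai i)
  : op R (tensT Ai) L := fun b r => phi (b i) * V (upd b x) r.

(** Since phi is a unit vector, N_x^* N_y = V^* (|x><y| ⊗ 1) V: the Kraus label x retains the full
    information on the erased site, and weighting with T rebuilds T on that site. *)
Lemma erasure_moment L (V : op R (tensT Ai) L) i (phi : Ai i -> C)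
    (T : op R (Ai i) (Ai i)) r r' :
  \sum_x Num.conj (phi x) * phi x = 1 ->
  \sum_x \sum_y T x y *
     opmul (qadj (erasure_kraus V phi x)) (erasure_kraus V phi y) r r' =
  opmul (qadj V) (opmul (site_op T) V) r r'.
Proof.
move=> phi1.
pose h (a : tensT Ai) := \sum_y T (a i) y * (Num.conj (V a r) * V (upd a y) r').
transitivity (\sum_a h a); last first.
  apply: eq_bigr => a _; rewrite [in RHS]/opmul site_op_sum mulr_sumr.
  by apply: eq_bigr => y _; rewrite /qadj; ring.
rewrite -[RHS]mul1r -phi1 -sum_upd.
transitivity (\sum_x \sum_y \sum_(b : tensT Ai) T x y *
   (Num.conj (phi (b i)) * phi (b i) * (Num.conj (V (upd b x) r) * V (upd b y) r'))).
  apply: eq_bigr => x _; apply: eq_bigr => y _; rewrite /opmul mulr_sumr.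
  by apply: eq_bigr => b _; rewrite /qadj /erasure_kraus rmorphM /=; ring.
under eq_bigr do rewrite exchange_big /=.
rewrite exchange_big; apply: eq_bigr => b _ /=.
rewrite mulr_sumr; apply: eq_bigr => x _; rewrite /h mulr_sumr.
by apply: eq_bigr => y _; rewrite upd_same upd_upd; ring.
Qed.

Lemma kraus_erasure L (V : op R (tensT Ai) L) i (phi : Ai i -> C) :
  kraus (erasure_kraus V phi) (erasure phi \o encode V).
Proof.
move=> X b b' /=; rewrite /erasure mulr_sumr; apply: eq_bigr => x _.
rewrite /encode /opmul mulr_sumr; apply: eq_bigr => r' _.
rewrite !mulr_suml mulr_sumr; apply: eq_bigr => r _.
by rewrite /erasure_kraus /qadj rmorphM /=; ring.
Qed.

End Tensor.
End Bounds.

(** * Covariant codes *)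

Section Covariant.
Variable R : realType.
Local Notation C := (R[i]).
Local Notation rc := (real_complex R).
Local Notation Re := (@complex.Re R).
Implicit Types A B L J T : finType.

(** Every recovery channel has a complete Kraus family, so a bound on [eps_e] need only be proved
    for the composed families K_j N_t. *)
Lemma eps_bound L B T (N : T -> op R B L) (M : op R L L -> op R B B) (w a : R) :
  (0 < #|L|)%N -> kraus N M -> 0 <= a ->
  (forall J (K : J -> op R L B), complete K ->
     efid (fun p : J * T => opmul (K p.1) (N p.2)) <= 1 /\
     w <= a * Num.sqrt (1 - efid (fun p : J * T => opmul (K p.1) (N p.2)))) ->
  w <= a * eps_e M.
Proof.
move=> L0 hN a0 h; apply: bound_sqrt_sup => //.
  by have [Rc cRc] := @channel_exists R B L L0; exists (fidelity (ext (Rc \o M) (@maxent R L)) (@maxent R L)), Rc.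
move=> x [Rc [/channel_kraus[J [K [kK cK]]] ->]].
have [h1 h2] := h _ _ cK.
have [c0 ->] := fidelity_kraus L0 (kraus_comp hN kK) (efidE _).
rewrite sqrtr_ge0 sqr_sqrtr //; split=> //.
by rewrite -sqrtr1 ler_sqrt.
Qed.

(** This is how the recovery drops out of the expectation of T_i ⊗ Z: summed over its Kraus label,
    it preserves all Gram operators. *)
Lemma complete_gram A B L J (K : J -> op R B A) (Y Y' : op R A L) r r' : complete K ->
  \sum_j opmul (qadj (opmul (K j) Y)) (opmul (K j) Y') r r' = opmul (qadj Y) Y' r r'.
Proof.
move=> cK.
transitivity (\sum_j opmul (qadj Y) (opmul (opmul (qadj (K j)) (K j)) Y') r r').
  by apply: eq_bigr => j _; rewrite qadj_mul !opmulA.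
rewrite -opmul_sumr; congr (opmul _ _ _ _).
apply: op_ext => a s; rewrite -opmul_suml.
have -> : (fun a b => \sum_t opmul (qadj (K t)) (K t) a b) = @op1 R A.
  by apply: op_ext => x y; rewrite cK.
by rewrite opmul1l.
Qed.

Section Code.
Variables (n : nat) (Ai : 'I_n -> finType) (L : finType) (V : op R (tensT Ai) L).
Hypothesis L0 : (0 < #|L|)%N.
Hypothesis VV : opmul (qadj V) V = @op1 R L.

Lemma site_op_shift i (T T' : op R (Ai i) (Ai i)) (m : C) :
  (forall x y, T' x y = T x y - m * (x == y)%:R) ->
  opmul (site_op T') V = opadd (opmul (site_op T) V) (opscale (- m) V).
Proof.
move=> TE; apply: op_ext => a r; rewrite /opadd /opscale {1 2}/opmul !site_op_sum.
under eq_bigr do rewrite TE mulrBl.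
rewrite sumrB; congr (_ + _).
rewrite (bigD1 (a i)) //= eqxx mulr1 upd_id big1 ?addr0 ?mulNr // => y yi.
by rewrite eq_sym (negPf yi) mulr0 mul0r.
Qed.

Lemma erasure_complete i (phi : Ai i -> C) :
  \sum_x Num.conj (phi x) * phi x = 1 -> complete (erasure_kraus V phi).
Proof.
move=> phi1 r r'.
transitivity (\sum_x \sum_y (x == y)%:R * opmul (qadj (erasure_kraus V phi x)) (erasure_kraus V phi y) r r').
  apply: eq_bigr => x _; rewrite (bigD1 x) //= eqxx mul1r big1 ?addr0 // => y yx.
  by rewrite eq_sym (negPf yx) mul0r.
rewrite (erasure_moment V (@op1 R (Ai i)) r r' phi1).
(* The identity is read as 0 - (-1) 1, which makes its site operator a shift of the zero one. *)
rewrite (site_op_shift (T := @op0 R _ _) (m := -1)); last by move=> x y; rewrite /op1 /op0; ring.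
have -> : opmul (site_op (@op0 R (Ai i) (Ai i))) V = @op0 R _ _.
  by apply: op_ext => a s; rewrite /opmul site_op_sum big1 // => y _; rewrite mul0r.
have -> : opadd (@op0 R (tensT Ai) L) (opscale (- -1) V) = V.
  by apply: op_ext => a s; rewrite /opadd /opscale /op0 opprK mul1r add0r.
by rewrite VV.
Qed.

(** [family_bound] is applied to G_{jx} = K_j N_x with the spectrum of T centred. The centring
    constant contributes a multiple of tr (V^* V Z) = tr Z = 0, so the expectation of T itself is
    bounded. *)
Lemma site_bound J (K : J -> op R L (tensT Ai)) i (phi : Ai i -> C)
    (T : op R (Ai i) (Ai i)) (W : op R L L) (g : L -> R) :
  complete K -> \sum_x Num.conj (phi x) * phi x = 1 -> qhermitian T ->
  qunitary W -> (forall k, `|g k| <= 1) -> \sum_k g k = 0 ->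
  let c := efid (fun p : J * Ai i => opmul (K p.1) (erasure_kraus V phi p.2)) in
  [/\ 0 <= spread T, c <= 1 &
  Re (qtr (opmul (opmul (qadj V) (opmul (site_op T) V)) (fcal W g)))
    <= spread T * #|L|%:R * Num.sqrt (1 - c)].
Proof.
move=> cK phi1 /spectral[U [f [Uu ->]]] Wu g1 g0 c.
(* A unit vector phi exists only on a nonempty site; [spread_fcal] needs a point of it. *)
have [x0 _] : exists x : Ai i, true.
  apply: contrapT => h; move/eqP: phi1; rewrite big1 ?(eq_sym 0) ?oner_eq0 //.
  by move=> x _; case: h; exists x.
have [s0 [m hm]] := spread_fcal f x0 Uu.
pose G (p : J * Ai i) := opmul (K p.1) (erasure_kraus V phi p.2).
have nG : \sum_p qtr (opmul (qadj (G p)) (G p)) = #|L|%:R.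
  rewrite -(pair_bigA _ (fun j x => qtr (opmul (qadj (G (j, x))) (G (j, x))))) /=.
  rewrite exchange_big -(@qtr1 R) /qtr /=.
  under eq_bigr do rewrite exchange_big /=.
  rewrite exchange_big; apply: eq_bigr => r _ /=.
  rewrite /op1 -(erasure_complete phi1); apply: eq_bigr => x _.
  exact: complete_gram.
have t0 : 0 <= spread (fcal U f) / 2 by rewrite divr_ge0.
have [c1 h] := family_bound L0 Uu Wu hm t0 g1 g0 nG.
split=> //; apply: le_trans (le_trans h _); last first.
  by have -> : 2 * (spread (fcal U f) / 2) = spread (fcal U f) by field.
suff -> : \sum_x \sum_y fcal U (fun k => f k - m) x y *
    \sum_j qtr (opmul (opmul (qadj (G (j, x))) (G (j, y))) (fcal W g)) =
    qtr (opmul (opmul (qadj V) (opmul (site_op (fcal U f)) V)) (fcal W g)) by [].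
have shift x y : fcal U (fun k => f k - m) x y = fcal U f x y - rc m * (x == y)%:R.
  rewrite -fcalD (_ : fcal U (fun k => - m) = opscale (rc (- m)) (@op1 R _)) ?fcal_cst //.
  by rewrite /opadd /opscale /op1 rmorphN mulNr.
transitivity (qtr (opmul (opmul (qadj V) (opmul (site_op (fcal U (fun k => f k - m))) V)) (fcal W g))); last first.
  rewrite (site_op_shift shift) opmulDr opmulZr VV opmulDl opmulZl opmul1l qtrD qtrZ.
  by rewrite qtr_fcal // g0 mulr0 addr0.
transitivity (\sum_r \sum_r' \sum_x \sum_y fcal U (fun k => f k - m) x y *
   opmul (qadj (erasure_kraus V phi x)) (erasure_kraus V phi y) r r' * fcal W g r' r); last first.
  apply: eq_bigr => r _; rewrite [RHS]/opmul; apply: eq_bigr => r' _.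
  rewrite -(erasure_moment V _ r r' phi1) mulr_suml; apply: eq_bigr => x _.
  by rewrite mulr_suml.
under [RHS]eq_bigr do rewrite exchange_big /=.
rewrite [RHS]exchange_big; apply: eq_bigr => x _ /=.
under [RHS]eq_bigr do rewrite exchange_big /=.
rewrite [RHS]exchange_big; apply: eq_bigr => y _ /=.
rewrite exchange_big mulr_sumr; apply: eq_bigr => r _ /=.
rewrite exchange_big mulr_sumr; apply: eq_bigr => r' _ /=.
rewrite -mulr_suml mulrA; congr (_ * _ * _); exact: complete_gram.
Qed.
Unset Implicit Arguments.

Variables (TL : op R L L) (T : forall i : 'I_n, op R (Ai i) (Ai i)) (nu : R)
  (phi : forall i : 'I_n, Ai i -> C).
Hypothesis TLh : qhermitian TL.
Hypothesis Th : forall i, qhermitian (T i).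
Hypothesis cov : opmul (local_sum T) V = opmul V (opadd TL (opscale (- rc nu) (@op1 R L))).
Hypothesis phi1 : forall i, \sum_x Num.conj (phi i x) * phi i x = 1.
Set Implicit Arguments.
Let d : R := #|L|%:R.
Let TL0 := opadd TL (opscale (- (qtr TL / rc d)) (@op1 R L)).

(* [z i] is [Re tr (V^* T_i V Z)]. *)
Lemma charge_split : exists z : 'I_n -> R, \sum_i z i = tnorm TL0 / 2 /\
  forall i J (K : J -> op R L (tensT Ai)), complete K ->
    let c := efid (fun p : J * Ai i => opmul (K p.1) (erasure_kraus V (phi i) p.2)) in
    [/\ 0 <= spread (T i), c <= 1 & z i <= spread (T i) * d * Num.sqrt (1 - c)].
Proof.
have d0 : (#|L|%:R : C) != 0 by rewrite pnatr_eq0 -lt0n.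
have dE : rc d = #|L|%:R by rewrite rmorph_nat.
have [W [l [Wu TLE]]] := spectral TLh.
pose m := (\sum_k l k) / d.
have trTL : qtr TL = rc (\sum_k l k) by rewrite TLE qtr_fcal.
have TL0E : TL0 = fcal W (fun k => l k - m).
  rewrite /TL0 trTL -fmorph_div -/m -fcalD -TLE; congr opadd.
  by rewrite (fcal_cst (- m) Wu) rmorphN.
have l0 : \sum_k (l k - m) = 0.
  by rewrite sumrB sumr_const -[m *+ _]mulr_natr divfK ?subrr // pnatr_eq0 -lt0n.
have [g [g1 gs trg]] := traceless_sign L0 Wu l0.
rewrite -TL0E in trg.
(* The same Z serves every site and every recovery, so these numbers can be summed over i before any
   recovery is chosen. *)
exists (fun i => Re (qtr (opmul (opmul (qadj V) (opmul (site_op (T i)) V)) (fcal W g)))).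
split; last by move=> i J K cK; exact: site_bound.
transitivity (Re (qtr (opmul (opmul (qadj V) (opmul (local_sum T) V)) (fcal W g)))); last first.
  (* Covariance and V^* V = 1 reduce the sum to tr ((T_L - nu) Z). Both nu and the mean of T_L pair
     with tr Z = 0, so T_L - nu may be replaced by [TL0]. *)
  rewrite cov opmulA VV opmul1l.
  have -> : tnorm TL0 / 2 = Re (qtr (opmul TL0 (fcal W g))) by rewrite trg.
  by rewrite /TL0 !opmulDl !opmulZl opmul1l !qtrD !qtrZ qtr_fcal // gs !mulr0.
rewrite -(big_morph Re (@ReD R) (erefl : Re 0 = 0)); congr Re.
rewrite /qtr exchange_big; apply: eq_bigr => r _ /=.
rewrite -opmul_suml; congr (opmul _ _ _ _); apply: op_ext => s s'.
rewrite -opmul_sumr; congr (opmul _ _ _ _); apply: op_ext => a s''.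
by rewrite -opmul_suml.
Qed.
End Code.
End Covariant.

(** * Random erasure *)

Section Mixed.
Variable R : realType.
Local Notation C := (R[i]).
Local Notation rc := (real_complex R).
Variables (n : nat) (Ai : 'I_n -> finType) (L : finType) (V : op R (tensT Ai) L).
Unset Implicit Arguments.
Variables (q : 'I_n -> R) (phi : forall i : 'I_n, Ai i -> C).
Hypothesis q0 : forall i, 0 <= q i.
Set Implicit Arguments.

(** The operators sqrt(q_i) |i>_C ⊗ N^i_x; a dependent pair (i, x) is the label because the erased
    register varies with the site. *)
Definition mixed_kraus (t : {i : 'I_n & Ai i}) : op R ('I_n * tensT Ai)%type L :=
  fun s r => (s.1 == tag t)%:R * rc (Num.sqrt (q (tag t))) *
    erasure_kraus V (phi (tag t)) (tagged t) s.2 r.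

Lemma kraus_mixed : kraus mixed_kraus (mixed_erasure q phi \o encode V).
Proof.
move=> X [c b] [c' b'] /=; rewrite /mixed_erasure /=.
have -> : erasure (phi c) (encode V X) b b' = (erasure (phi c) \o encode V) X b b' by [].
rewrite kraus_erasure.
pose F i (x : Ai i) := (c == i)%:R * (c' == i)%:R * rc (q i) *
  opmul (opmul (erasure_kraus V (phi i) x) X) (qadj (erasure_kraus V (phi i) x)) b b'.
transitivity (\sum_t F (tag t) (tagged t)); last first.
  apply: eq_bigr => t _; rewrite /F [in LHS]/opmul [in RHS]/opmul mulr_sumr.
  apply: eq_bigr => r' _; rewrite /opmul !mulr_suml !mulr_sumr.
  apply: eq_bigr => r _; rewrite /mixed_kraus /qadj /= !rmorphM /= conj_rc conjC_nat.
  by rewrite -[X in rc X](sqr_sqrtr (q0 (tag t))) rmorphXn /=; ring.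
rewrite -(sig_big_dep xpredT (fun _ _ => true) F) /= (bigD1 c) //= [X in _ + X]big1 ?addr0.
  rewrite mulr_sumr; apply: eq_bigr => x _.
  by rewrite /F eqxx mul1r [c' == c]eq_sym.
move=> i ic; rewrite big1 // => x _; by rewrite /F [c == i]eq_sym (negPf ic) !mul0r.
Qed.

(** The flag |i> selects one block of each K_j, so every trace comes from a single site with
    amplitude sqrt(q_i), and squaring leaves the weight q_i. *)
Lemma efid_mixed (J : finType) (K : J -> op R L ('I_n * tensT Ai)%type) :
  efid (fun p : J * {i : 'I_n & Ai i} => opmul (K p.1) (mixed_kraus p.2)) =
  \sum_i q i * efid (fun p : J * Ai i =>
    opmul (fun l b => K p.1 l (i, b)) (erasure_kraus V (phi i) p.2)).
Proof.
apply: complexI; rewrite efidE rmorph_sum /=.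
pose tK j i (x : Ai i) := qtr (opmul (fun l b => K j l (i, b)) (erasure_kraus V (phi i) x)).
have trE j t : qtr (opmul (K j) (mixed_kraus t)) =
    rc (Num.sqrt (q (tag t))) * tK j (tag t) (tagged t).
  rewrite /tK /qtr mulr_sumr; apply: eq_bigr => l _; rewrite /opmul mulr_sumr.
  rewrite (eq_bigr (fun s : 'I_n * tensT Ai => K j l (s.1, s.2) * mixed_kraus t (s.1, s.2) l)); last by case.
  rewrite -(pair_bigA _ (fun c b => K j l (c, b) * mixed_kraus t (c, b) l)) /=.
  rewrite (bigD1 (tag t)) //= [X in _ + X]big1 ?addr0.
    by apply: eq_bigr => b _; rewrite /mixed_kraus /= eqxx /=; ring.
  by move=> c ct; rewrite big1 // => b _; rewrite /mixed_kraus /= (negPf ct) !mul0r mulr0.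
rewrite -(pair_bigA _ (fun j t => Num.conj (qtr (opmul (K j) (mixed_kraus t))) * qtr (opmul (K j) (mixed_kraus t)))) /=.
pose F j i (x : Ai i) := rc (q i) * (Num.conj (tK j i x) * tK j i x).
transitivity ((\sum_j \sum_t F j (tag t) (tagged t)) / #|L|%:R ^+ 2).
  congr (_ / _); apply: eq_bigr => j _; apply: eq_bigr => t _; rewrite trE /F.
  rewrite -[X in rc X * (Num.conj _ * _)](sqr_sqrtr (q0 (tag t))) rmorphXn !rmorphM /= conj_rc; ring.
rewrite (eq_bigr (fun j => \sum_i \sum_x F j i x)); last first.
  by move=> j _; rewrite (sig_big_dep xpredT (fun _ _ => true) (F j)).
rewrite exchange_big mulr_suml; apply: eq_bigr => i _ /=.
rewrite rmorphM /= efidE mulrA; congr (_ / _).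
rewrite -(pair_bigA _ (fun j x => Num.conj (tK j i x) * tK j i x)) /= mulr_sumr.
by apply: eq_bigr => j _; rewrite mulr_sumr.
Qed.
End Mixed.

(** * Convexity of the square and the two error bounds *)

Lemma sqr_mean_le (R : realType) (I : finType) (q s : I -> R) :
  (forall i, 0 <= q i) -> \sum_i q i = 1 ->
  (\sum_i q i * s i) ^+ 2 <= \sum_i q i * s i ^+ 2.
Proof.
move=> q0 q1; set m := \sum_i q i * s i.
(* The variance of [s] under the distribution [q]. *)
have : 0 <= \sum_i q i * (s i - m) ^+ 2.
  by apply: sumr_ge0 => i _; rewrite mulr_ge0 ?sqr_ge0.
have E x : \sum_i q i * (s i - x) ^+ 2 =
    \sum_i q i * s i ^+ 2 - 2 * x * (\sum_i q i * s i) + x ^+ 2 * \sum_i q i.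
  by rewrite !mulr_sumr -sumrB -big_split; apply: eq_bigr => i _ /=; ring.
rewrite E -/m q1 => h; rewrite -subr_ge0.
by have -> : \sum_i q i * s i ^+ 2 - m ^+ 2 =
  \sum_i q i * s i ^+ 2 - 2 * m * m + m ^+ 2 * 1 by ring.
Qed.

(** Each diagonal block of the completeness relation is one itself, so the restriction of a recovery
    to flag i is a recovery for the i-th erasure. *)
Lemma complete_block (R : realType) (J L I A : finType) (K : J -> op R L (I * A)%type) (i : I) :
  complete K -> complete (fun j l (b : A) => K j l (i, b)).
Proof.
move=> cK b b'; have := cK (i, b) (i, b').
by rewrite xpair_eqE eqxx.
Qed.

Theorem theorem6 (R : realType) (L : finType) (n : nat) (Ai : 'I_n -> finType)
  (V : op R (tensT Ai) L) (TL : op R L L) (T : forall i : 'I_n, op R (Ai i) (Ai i))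
  (nu : R) (phi : forall i : 'I_n, Ai i -> R[i]) :
  (0 < #|L|)%N ->
  opmul (qadj V) V = @op1 R L ->
  qhermitian TL ->
  (forall i, qhermitian (T i)) ->
  opmul (local_sum T) V = opmul V (opadd TL (opscale (- real_complex R nu) (@op1 R L))) ->
  (forall i, \sum_(x : Ai i) Num.conj (phi i x) * phi i x = 1) ->
  let dL : R := #|L|%:R in
  let TL0 := opadd TL (opscale (- (qtr TL / real_complex R dL)) (@op1 R L)) in
  (1 / (2 * dL)) * tnorm TL0
    <= \sum_(i < n) spread (T i) * eps_e (erasure (phi i) \o encode V)
  /\
  (forall q : 'I_n -> R, (forall i, 0 < q i) -> \sum_(i < n) q i = 1 ->
     eps_e (mixed_erasure q phi \o encode V)
       >= (1 / (2 * dL)) * tnorm TL0 / \big[Num.max/0]_(i < n) ((q i)^-1 * spread (T i))).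
Proof.
move=> L0 VV TLh Th cov phi1 dL TL0.
have dp : 0 < dL by rewrite ltr0n.
have [z [zs zb]] := charge_split L0 VV TLh Th cov phi1.
have s0 i : 0 <= spread (T i).
  (* Any recovery will do here, since [zb] delivers the sign of the spread along with its bound. *)
  have [Rc /channel_kraus[J [K [_ cK]]]] := @channel_exists R (tensT Ai) L L0.
  by have [] := zb i _ _ cK.
have XE : (1 / (2 * dL)) * tnorm TL0 = \sum_i z i / dL.
  rewrite -mulr_suml zs -/dL.
  move: (tnorm _) => tn; field; exact: lt0r_neq0.
rewrite XE; split.
  apply: ler_sum => i _; rewrite ler_pdivrMr // mulrAC.
  apply: (eps_bound L0 (kraus_erasure V (phi i))); first by rewrite mulr_ge0 // ltW.
  by move=> J K cK; have [] := zb i _ _ cK.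
move=> q qp q1; set M := \big[Num.max/0]_(i < n) _.
have q0 i : 0 <= q i by exact: ltW.
have M0 : 0 <= M by exact: bigmax_ge_id.
(* If all spreads vanish, division by zero makes the lower bound 0. *)
have [M_eq0|M_neq0] := eqVneq M 0; first by rewrite M_eq0 invr0 mulr0 sqrtr_ge0.
rewrite ler_pdivrMr ?lt_def ?M_neq0 // [leRHS]mulrC.
apply: (eps_bound L0 (kraus_mixed V phi q0)) => // J K cK.
rewrite efid_mixed //.
set c := fun i => efid (fun p : J * Ai i => opmul (fun l b => K p.1 l (i, b)) (erasure_kraus V (phi i) p.2)).
have cb i := zb i _ _ (complete_block i cK).
have c1 i : c i <= 1 by have [] := cb i.
have qc1 : 1 - \sum_i q i * c i = \sum_i q i * Num.sqrt (1 - c i) ^+ 2.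
  rewrite -{1}q1 -sumrB; apply: eq_bigr => i _; rewrite sqr_sqrtr ?subr_ge0 //; ring.
have c_le : 0 <= 1 - \sum_i q i * c i.
  by rewrite qc1; apply: sumr_ge0 => i _; rewrite mulr_ge0 ?sqr_ge0.
split; first by rewrite -subr_ge0.
(* The spread of T_i is at most M q_i, which turns the single-site bounds into a mean under q;
   convexity then moves that mean inside the square root. *)
apply: (@le_trans _ _ (M * \sum_i q i * Num.sqrt (1 - c i))).
  rewrite mulr_sumr; apply: ler_sum => i _; rewrite ler_pdivrMr //.
  have [_ _ zi] := cb i; apply: le_trans zi _.
  have sM : spread (T i) <= M * q i.
    rewrite -ler_pdivrMr // mulrC; exact: le_bigmax.
  rewrite -/dL -/(c i) mulrA mulrAC; apply: ler_wpM2r; first exact: ltW.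
  by apply: ler_wpM2r; first exact: sqrtr_ge0.
apply: ler_wpM2l => //; apply: sqr_le; first exact: sqrtr_ge0.
by rewrite sqr_sqrtr // qc1; exact: sqr_mean_le.
Qed.
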